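(* In the setting of the context (with $\mathcal X$, $\mathcal Y$, $\mathcal Z=\mathcal X\times\mathcal Y$, $Q$, $\nu$, $K$, $\mathcal H_K$, $g$, $\mathcal P_K(\mathcal Z)$, $r_g^\mu$ and $f_{S_m}$ as defined there), assume $$\sup_{\mu\in\mathcal P_K(\mathcal Z)}\mathbb E_{\mu_{\mathcal Y}}\bigl[|g|^2\bigr]\le M<\infty .$$ Let $(\gamma_m)_{m\in\mathbb N^+}$ be a sequence of positive real numbers (regularization parameters) such that there exists a sequence of positive real numbers $(\beta_m)_{m\in\mathbb N^+}$ with $$\lim_{m\to\infty}\gamma_m=0,\qquad \lim_{m\to\infty}\beta_m\sqrt{\gamma_m}=\infty,\qquad \lim_{m\to\infty}\frac{m\gamma_m}{\beta_m^2\log m}=+\infty .$$ Then for any $\mu\in\mathcal P_K(\mathcal Z)$ and any $\varepsilon>0$, $$\lim_{m\to\infty}(\mu^m)^*\bigl\{S_m\in\mathcal Z^m:\ \|f_{S_m}-r_g^\mu\|_{\mathcal H_K}\ge\varepsilon\bigr\}=0 .$$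
   Context: $\mathcal X\subset\mathbb R^d$ is a compact smooth Riemannian submanifold (with induced metric), $\mathcal Y$ is a measurable space, $\mathcal Z=\mathcal X\times\mathcal Y$, and $\mathcal P(\cdot)$ denotes the set of probability measures. $Q\subset\mathbb R^d$ is a compact rectangle with $\mathcal X\subset\operatorname{int}(Q)$, and $\nu$ is the normalized Lebesgue measure on $Q$. $K:\mathcal X\times\mathcal X\to\mathbb R$ is a smooth Mercer kernel (smooth, symmetric, positive semidefinite) and $\mathcal H_K$ is its reproducing kernel Hilbert space, which consists of smooth functions on $\mathcal X$. $g:\mathcal Y\to\mathbb R$ is a fixed measurable function. For $\mu\in\mathcal P(\mathcal Z)$, $\mu_{\mathcal X},\mu_{\mathcal Y}$ are its marginals. It is assumed throughout that every $\mu$ considered admits a regular conditional probability $\mu_{\mathcal Y|\mathcal X}:\mathcal X\to\mathcal P(\mathcal Y)$ with respect to the projection to $\mathcal X$; the regular conditional expectation is $r_g^\mu(x)=\int_{\mathcal Y}g(y)\,d\mu_{\mathcal Y|\mathcal X}(y\mid x)$ (for $g\in L^1(\mu_{\mathcal Y})$), defined up to $\mu_{\mathcal X}$-a.e. equality. $\mathcal P_K(\mathcal Z)$ is the set of all such $\mu\in\mathcal P(\mathcal Z)$ satisfying: (i) $\operatorname{supp}(\mu_{\mathcal X})=\mathcal X$; (ii) the conditional expectation admits a version $r_g^\mu\in\mathcal H_K$ (this version is what $r_g^\mu$ denotes). For $a,x\in\mathbb R^d$ let $I^{(d)}(a,x)=\prod_{i=1}^d 1_{[0,\infty)}(a_i-x_i)$.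 For $S_m=((x_1,y_1),\dots,(x_m,y_m))\in\mathcal Z^m$, $f\in\mathcal H_K$ and $a\in Q$ set $$(A_{S_m}f)(a)=\frac1m\sum_{i=1}^m I^{(d)}(a,x_i)f(x_i),\qquad B^g_{S_m}(a)=\frac1m\sum_{i=1}^m I^{(d)}(a,x_i)g(y_i).$$ For $\gamma_m>0$, $f_{S_m}\in\mathcal H_K$ is the unique minimizer over $f\in\mathcal H_K$ of $$\|A_{S_m}f-B^g_{S_m}\|_{L^2(Q,\nu)}^2+\gamma_m\|f\|_{\mathcal H_K}^2 .$$ $(\mu^m)^*$ is the outer measure defined by the product measure $\mu^m$ on $\mathcal Z^m$. *)

(* Defs.v *)
From HB Require Import structures.
From mathcomp Require Import all_boot all_order all_algebra.
From mathcomp Require Import all_classical all_reals all_analysis.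
Import Order.TTheory GRing.Theory Num.Theory.
Import numFieldNormedType.Exports.

Set Implicit Arguments.
Unset Strict Implicit.
Unset Printing Implicit Defensive.

Local Open Scope classical_set_scope.
Local Open Scope ring_scope.

Section smooth.
Context {R : realType}.

(* Directional derivatives in all directions are used instead of partial
   derivatives, so that V may be a product of spaces of row vectors; in finite
   dimension this is the usual notion of a C^k map on the open set U. *)
Fixpoint Ck {V W : normedModType R} (k : nat) (U : set V) (f : V -> W) : Prop :=
  (forall x, U x -> {for x, continuous f}) /\
  match k with
  | 0 => True
  | k.+1 => forall v : V,
      (forall x, U x -> derivable f x v) /\ Ck k U (fun x => 'D_v f x)
  end.

Definition smooth_on {V W : normedModType R} (U : set V) (f : V -> W) : Prop :=
  forall k, Ck k U f.

(* Embedded submanifold without boundary, given by slice charts: near each of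
   its points, X is straightened to R^n x {0} by a diffeomorphism phi, with
   inverse psi, between open subsets of R^d. *)
Definition smooth_submanifold (d : nat) (X : set 'rV[R]_d) : Prop :=
  exists2 n, (n <= d)%N & forall p, X p ->
    exists (U V : set 'rV[R]_d) (phi psi : 'rV[R]_d -> 'rV[R]_d),
      [/\ open U, U p, open V, smooth_on U phi & smooth_on V psi] /\
      [/\ forall x, U x -> V (phi x) /\ psi (phi x) = x,
          forall y, V y -> U (psi y) /\ phi (psi y) = y &
          forall x, U x ->
            (X x <-> forall i : 'I_d, (n <= i)%N -> phi x 0 i = 0)].

(* A function on X x X is smooth when it is locally the restriction of a smooth
   function on an open subset of R^d x R^d. *)
Definition smooth_kernel (d : nat) (X : set 'rV[R]_d) (K : X -> X -> R) : Prop :=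
  forall p q : X, exists (U : set ('rV[R]_d * 'rV[R]_d)%type)
      (F : ('rV[R]_d * 'rV[R]_d)%type -> R),
    [/\ open U, U (\val p, \val q), smooth_on U F &
        forall x y : X, U (\val x, \val y) -> K x y = F (\val x, \val y)].

Definition psd_kernel (T : Type) (K : T -> T -> R) : Prop :=
  forall (n : nat) (x : 'I_n -> T) (c : 'I_n -> R),
    0 <= \sum_(i < n) \sum_(j < n) c i * c j * K (x i) (x j).

Definition smooth_mercer_kernel (d : nat) (X : set 'rV[R]_d)
    (K : X -> X -> R) : Prop :=
  [/\ smooth_kernel K, (forall x y, K x y = K y x) & psd_kernel K].

End smooth.

(* H is the reproducing kernel Hilbert space of K: its elements are identified
   with functions on T through the injective linear map rkhs_eval, its norm is
   complete and comes from the inner product rkhs_dot, it contains the sections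
   K(x, .), and these reproduce evaluations.  H is determined by K up to an
   isometry commuting with rkhs_eval. *)
Record rkhs {R : realType} {T : Type} (K : T -> T -> R)
    (H : completeNormedModType R) := Rkhs {
  rkhs_dot : {dot H for idfun};
  rkhs_norm : forall f : H, `|f| ^+ 2 = rkhs_dot f f;
  rkhs_eval : {linear H -> (T -> R^o)};
  rkhs_inj : injective rkhs_eval;
  rkhs_section : T -> H;
  rkhs_sectionE : forall x, rkhs_eval (rkhs_section x) = K x;
  rkhs_reproducing : forall (f : H) x,
    rkhs_eval f x = rkhs_dot f (rkhs_section x) }.

(* The subspace X with its Borel sigma-algebra.  The nonemptiness proof X0 is
   there because a measurableType is pointed. *)
Section borel_subspace.
Context {V : topologicalType} (X : set V) (X0 : X !=set0).

Definition subspace_pt : Type := X.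
HB.instance Definition _ := Choice.on subspace_pt.
HB.instance Definition _ := isPointed.Build subspace_pt
  (SigSub (mem_set (projT2 (cid X0)))).

Definition rel_open : set (set subspace_pt) :=
  [set (fun x : subspace_pt => U (\val x)) | U in open].

Definition borel_sub : measurableType rel_open.-sigma :=
  g_sigma_algebraType rel_open.

End borel_subspace.

(* The sigma-algebra of R^d generated by the coordinates (as the library does
   for tuples); it coincides with the Borel one. *)
Section measurable_rV.
Context {R : realType} (d : nat).

Definition rV_coord (i : 'I_d) (a : 'rV[R]_d) : measurableTypeR R := a 0 i.

HB.instance Definition _ := @isMeasurable.Build
  (measure_tuple_display R.-ocitv.-measurable.-sigma) 'rV[R]_d
  (g_sigma_preimage rV_coord) (@sigma_algebra0 _ _ _) (@sigma_algebraC _ _)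
  (@sigma_algebra_bigcup _ _ _).

End measurable_rV.

(* The library's pushforward carries a measure structure only when the
   measurability of the map can be inferred; here its proof is an argument. *)
Section measure_image.
Context d1 d2 (T1 : measurableType d1) (T2 : measurableType d2) (R : realType).
Variables (m : {measure set T1 -> \bar R}) (f : T1 -> T2).
Variable mf : measurable_fun [set: T1] f.

Definition mimage of measurable_fun [set: T1] f : set T2 -> \bar R :=
  pushforward m f.

Let mimage0 : mimage mf set0 = 0%E.
Proof. by rewrite /mimage /pushforward preimage_set0 measure0. Qed.

Let mimage_ge0 A : (0 <= mimage mf A)%E.
Proof. by rewrite /mimage /pushforward; exact: measure_ge0. Qed.

Let mimage_sigma_additive : semi_sigma_additive (mimage mf).
Proof.
move=> F mF tF mUF.
apply: (@measure_semi_sigma_additive _ _ _ (pushforward _ _)) => //.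
Qed.

HB.instance Definition _ := isMeasure.Build _ _ _ (mimage mf)
  mimage0 mimage_ge0 mimage_sigma_additive.

End measure_image.

Section measure_power.
Context d (T : measurableType d) (R : realType).
Variable mu : {sigma_finite_measure set T -> \bar R}.

Definition tcons n (p : n.-tuple T * T) : n.+1.-tuple T := [tuple of p.2 :: p.1].

Lemma measurable_tcons n : measurable_fun setT (@tcons n).
Proof. exact: measurable_cons. Qed.

Fixpoint mpower n : {measure set (n.-tuple T) -> \bar R} :=
  match n with
  | 0 => \d_[tuple]
  | n.+1 => mimage (mpower n \x mu)%E (measurable_tcons (n := n))
  end.

End measure_power.

Section lebesgue_rV.
Context {R : realType} (d : nat).

Definition rV_of_tuple (t : d.-tuple (measurableTypeR R)) : 'rV[R]_d :=
  \row_i tnth t i.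

Lemma measurable_rV_coord (i : 'I_d) : measurable_fun setT (@rV_coord R d i).
Proof.
move=> _ A mA; rewrite setTI; apply: sub_sigma_algebra.
case: d i => [[] //|n] i; rewrite -bigcup_mkord_ord.
by exists i => //=; exists A => //; rewrite setTI inord_val.
Qed.

Lemma measurable_rV_of_tuple : measurable_fun setT rV_of_tuple.
Proof.
pose G := \big[setU/set0]_(i < d) preimage_set_system setT (@rV_coord R d i) measurable.
apply: (@measurability _ _ _ _ _ _ G) => // _ [B GB <-].
move: B GB; rewrite /G.
elim/big_ind: _ => [//|S1 S2 IH1 IH2 B [/IH1|/IH2]//|i _ _ [A mA <-]].
have -> : rV_of_tuple @^-1` (setT `&` @rV_coord R d i @^-1` A) =
    @tnth d (measurableTypeR R) ^~ i @^-1` A.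
  by rewrite setTI; apply/seteqP; split=> t; rewrite /= /rV_coord mxE.
exact: measurable_tnth.
Qed.

Definition lebesgue_rV : {measure set 'rV[R]_d -> \bar R} :=
  mimage (mpower lebesgue_measure d) measurable_rV_of_tuple.

Definition rectangle (lo hi : 'rV[R]_d) : set 'rV[R]_d :=
  [set a | forall i, lo 0 i <= a 0 i <= hi 0 i].

Lemma measurable_rectangle lo hi : measurable (rectangle lo hi).
Proof.
rewrite (_ : rectangle lo hi =
  \bigcap_(i in setT) (@rV_coord R d i @^-1` `[lo 0 i, hi 0 i])).
  apply: fin_bigcap_measurable => // i _; rewrite -[X in measurable X]setTI.
  by apply: measurable_rV_coord => //; exact: measurable_itv.
apply/seteqP; split=> a /= Qa i.
  by move=> _; rewrite /= in_itv; exact: Qa.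
by have := Qa i I; rewrite /= in_itv.
Qed.

Definition normalized_lebesgue (lo hi : 'rV[R]_d) : probability 'rV[R]_d R :=
  mnormalize (mrestr lebesgue_rV (measurable_rectangle lo hi)) \d_lo.

End lebesgue_rV.

Section setting.
Context {R : realType} {d : nat} {X : set 'rV[R]_d} (X0 : X !=set0).
Context {dY : measure_display} {Y : measurableType dY}.

Local Notation Z := (borel_sub X0 * Y)%type.

Definition marginalX (mu : probability Z R) : set (borel_sub X0) -> \bar R :=
  pushforward mu fst.

Definition marginalY (mu : probability Z R) : set Y -> \bar R :=
  pushforward mu snd.

Definition supportX (mu : probability Z R) : set X :=
  [set x | forall U : set 'rV[R]_d, open U -> U (\val x) ->
    (0 < marginalX mu (fun x' : X => U (\val x')))%E].

Definition regular_conditional_probability (mu : probability Z R)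
    (k : R.-pker borel_sub X0 ~> Y) : Prop :=
  forall A B, measurable A -> measurable B ->
    mu (A `*` B) = (\int[marginalX mu]_(x in A) k x B)%E.

Context {K : X -> X -> R} {H : completeNormedModType R} (HK : rkhs K H).
Variable g : Y -> R.

(* The choice of k is immaterial: two regular conditional probabilities of mu give
   integrals of g that agree almost everywhere. *)
Definition regression_version (mu : probability Z R) (f : H) : Prop :=
  exists2 k : R.-pker borel_sub X0 ~> Y, regular_conditional_probability mu k &
    \forall x \ae marginalX mu,
      (rkhs_eval HK f x)%:E = (\int[k x]_y (g y)%:E)%E.

(* Integrability of g is part of the definition, as the conditional expectation
   is only defined for g in L^1. *)
Definition P_K : set (probability Z R) :=
  [set mu | [/\ supportX mu = [set: X],
                (marginalY mu).-integrable [set: Y] (EFin \o g) &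
                exists f : H, regression_version mu f]].

Definition orthant_indicator (a x : 'rV[R]_d) : R :=
  \prod_(i < d) \1_`[0, +oo[ (a 0 i - x 0 i).

Definition empirical_op m (S : m.-tuple Z) (f : H) (a : 'rV[R]_d) : R :=
  m%:R^-1 * \sum_(i < m)
    orthant_indicator a (\val (tnth S i).1) * rkhs_eval HK f (tnth S i).1.

Definition empirical_rhs m (S : m.-tuple Z) (a : 'rV[R]_d) : R :=
  m%:R^-1 * \sum_(i < m)
    orthant_indicator a (\val (tnth S i).1) * g (tnth S i).2.

Definition objective (lo hi : 'rV[R]_d) (c : R) m (S : m.-tuple Z) (f : H) :
    \bar R :=
  ('N[normalized_lebesgue lo hi]_2%:E
      [EFin \o (fun a => empirical_op S f a - empirical_rhs S a)%R] ^+ 2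
   + (c * `|f| ^+ 2)%:E)%E.

(* The minimizer of the objective over H (it exists and is unique for c > 0). *)
Definition minimizer (lo hi : 'rV[R]_d) (c : R) m (S : m.-tuple Z) : H :=
  get [set f : H | forall f' : H,
    (objective lo hi c S f <= objective lo hi c S f')%E].

End setting.

Arguments P_K {R d X} X0 {dY Y K H} HK g.

(* Main.v *)
(* Write A and B for A_{S_m} and B^g_{S_m}, f for the minimizer, r for the
   regression function, u = f - r, and e = ||A r - B||^2.  For each a, the mean
   of I(a, x) (r(x) - g(y)) is 0 by disintegration, so E[e] = O(1 / m) by
   Tonelli's theorem, and e / gamma -> 0 in probability because the hypotheses
   on the rates imply m gamma -> +oo.

   Comparing the objective at f and at r gives |f|^2 <= |r|^2 + e / gamma, so u
   is bounded in probability, and ||A u||^2 <= 4 e + 2 gamma |r|^2 -> 0.  Moreover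
   |u|^2 = |f|^2 - |r|^2 - 2 <u, r> <= e / gamma - 2 <u, r>, so it suffices to
   show that <u, r> -> 0 in probability.  The v such that <u, v> -> 0 form a
   closed subspace, so one may take for v a section K_p, with <u, K_p> = u(p).
   To this end, pair A u with a bounded density h on Q such that the integral of
   I(a, x) h(a) is a product of tents in x around p: this gives the average of
   u over the sample points close to p, weighted by the tents.  The total weight
   stays away from 0 by the law of large numbers, as mu_X has full support, and
   u varies little near p since x |-> K_x is continuous. *)

Require Import Defs.
From HB Require Import structures.
From mathcomp Require Import all_boot all_order all_algebra.
From mathcomp Require Import all_classical all_reals all_analysis.
From mathcomp Require Import measurable_realfun ring lra.
Import Order.TTheory GRing.Theory Num.Theory.
Import numFieldNormedType.Exports.

Set Implicit Arguments.
Unset Strict Implicit.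
Unset Printing Implicit Defensive.

Local Open Scope classical_set_scope.
Local Open Scope ring_scope.

(** * Hilbert spaces with a reproducing kernel *)

Section minimization.
Context {R : realType} {H : completeNormedModType R}.

(* The term in [c] makes the minimizing sequences Cauchy. *)
Lemma strongly_convex_has_min (S : set H) (J : H -> R) (c : R) :
  S !=set0 -> closed S ->
  (forall x y, S x -> S y -> S (2^-1 *: (x + y))) ->
  0 < c -> (forall x, 0 <= J x) -> continuous J ->
  (forall x y, J (2^-1 *: (x + y)) + c * `|x - y| ^+ 2 <= (J x + J y) / 2) ->
  exists2 x, S x & forall y, S y -> J x <= J y.
Proof.
move=> S0 cS mS c0 J0 cJ convJ.
have hinf : has_inf (J @` S).
  split; first by case: S0 => x Sx; exists (J x), x.
  by exists 0 => _ [x _ <-].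
set l := inf (J @` S).
have ler y : S y -> l <= J y by move=> Sy; apply: ge_inf; [case: hinf|exists y].
have ex n : exists x, S x /\ J x < l + n.+1%:R^-1.
  have [_ [x Sx <-] Jx] : exists2 z, (J @` S) z & z < l + n.+1%:R^-1.
    by apply: inf_adherent; rewrite // invr_gt0.
  by exists x.
have [u uP] := choice ex.
have cu : cauchy (u n @[n --> \oo]).
  apply/cauchy_exP => e e0.
  have : (n.+1%:R^-1 : R) @[n --> \oo] --> (0 : R) by exact: cvg_harmonic.
  move=> /cvgrPdist_lt /(_ (c * e ^+ 2)) []; first by rewrite mulr_gt0// exprn_gt0.
  move=> N _ HN; exists (u N); exists N => // n /= Nn.
  rewrite -ball_normE /=.
  have h1 := HN N (leqnn N); have h2 := HN n Nn.
  rewrite /= sub0r normrN ger0_norm in h1; last by rewrite invr_ge0.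
  rewrite /= sub0r normrN ger0_norm in h2; last by rewrite invr_ge0.
  have [SN JN] := uP N; have [Sn Jn] := uP n.
  (* The midpoint has value at least [l], while [u N] and [u n] have values below [l + c * e ^+ 2];
     convexity leaves less than [c * e ^+ 2] for [c] times the squared distance. *)
  have h3 := ler _ (mS _ _ SN Sn).
  have h4 := convJ (u N) (u n).
  have h5 : c * `|u N - u n| ^+ 2 < c * e ^+ 2. 
    move: h1 h2 h3 h4 JN Jn; move: (N.+1%:R^-1) (n.+1%:R^-1) (c * _) (c * _).
    clear; move: (J (u N)) (J (u n)) (J _); clearbody l => *; lra.
  rewrite ltr_pM2l// in h5.
  by rewrite -(@ltr_pXn2r _ 2)// nnegrE// ltW.
have /cauchy_cvgP cvu := cu.
set x := lim (u n @[n --> \oo]) in cvu.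
exists x.
  apply: (@closed_cvg _ _ \oo _ u S cS _ x cvu).
  by apply: nearW => n; case: (uP n).
move=> y Sy; apply: le_trans (ler _ Sy).
have cJu : J (u n) @[n --> \oo] --> J x by apply: continuous_cvg => //; exact: cJ.
have cr : l + n.+1%:R^-1 @[n --> \oo] --> l.
  by rewrite -[X in _ --> X]addr0; apply: cvgD; [exact: cvg_cst|exact: cvg_harmonic].
apply: (ler_cvg_to cJu cr).
by apply: nearW => n; apply: ltW; case: (uP n).
Qed.

End minimization.

Section rkhs_theory.
Context {R : realType} {T : Type} {K : T -> T -> R} {H : completeNormedModType R}.
Variable HK : rkhs K H.
Implicit Types u v w : H.

Local Notation dot := (rkhs_dot HK).

Lemma rkhs_dotC u v : dot u v = dot v u.
Proof. by rewrite hermC expr0 mul1r. Qed.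

Lemma rkhs_dotDr u v w : dot u (v + w) = dot u v + dot u w.
Proof. exact: linearDr. Qed.

Lemma rkhs_dotZr a u v : dot u (a *: v) = a * dot u v.
Proof. exact: linearZr_LR. Qed.

Lemma rkhs_normD u v : `|u + v| ^+ 2 = `|u| ^+ 2 + 2 * dot u v + `|v| ^+ 2.
Proof.
rewrite !(rkhs_norm HK) rkhs_dotDr ![dot (u + v) _]rkhs_dotC !rkhs_dotDr.
by rewrite (rkhs_dotC v u); ring.
Qed.

Lemma rkhs_normB u v : `|u - v| ^+ 2 = `|u| ^+ 2 - 2 * dot u v + `|v| ^+ 2.
Proof.
by rewrite rkhs_normD normrN -scaleN1r rkhs_dotZr mulN1r mulrN.
Qed.

(** The parallelogram law, arranged as strong convexity of the squared norm with constant 1/4, which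
    is the shape that [strongly_convex_has_min] expects. *)
Lemma rkhs_parallelogram u v :
  `|2^-1 *: (u + v)| ^+ 2 + `|u - v| ^+ 2 / 4 = (`|u| ^+ 2 + `|v| ^+ 2) / 2.
Proof.
rewrite normrZ exprMn (rkhs_normD u v) (rkhs_normB u v) ger0_norm ?invr_ge0//.
by field.
Qed.

Lemma rkhs_cauchy_schwarz u v : `|dot u v| <= `|u| * `|v|.
Proof.
have [->|v0] := eqVneq v 0.
  by rewrite linear0r !normr0 mulr0.
have nv : 0 < `|v| by rewrite normr_gt0.
(* The vector is [u] minus its projection on [v]. *)
have h : 0 <= `|u - (dot u v / `|v| ^+ 2) *: v| ^+ 2 by rewrite exprn_ge0.
rewrite rkhs_normB rkhs_dotZr normrZ exprMn real_normK ?num_real// in h.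
have e : `|u| ^+ 2 - 2 * (dot u v / `|v| ^+ 2 * dot u v) +
  (dot u v / `|v| ^+ 2) ^+ 2 * `|v| ^+ 2 = `|u| ^+ 2 - dot u v ^+ 2 / `|v| ^+ 2.
  by field; rewrite gt_eqF.
rewrite e subr_ge0 ler_pdivrMr ?exprn_gt0// -exprMn in h.
by rewrite -(@ler_pXn2r _ 2) ?nnegrE ?mulr_ge0// real_normK ?num_real.
Qed.

Lemma rkhs_evalE u x : rkhs_eval HK u x = dot u (rkhs_section HK x).
Proof. exact: rkhs_reproducing. Qed.

Lemma rkhs_evalB u v x :
  rkhs_eval HK (u - v) x = rkhs_eval HK u x - rkhs_eval HK v x.
Proof. by rewrite raddfB. Qed.

Lemma rkhs_evalD u v x :
  rkhs_eval HK (u + v) x = rkhs_eval HK u x + rkhs_eval HK v x.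
Proof. by rewrite raddfD. Qed.

Lemma rkhs_evalZ a u x : rkhs_eval HK (a *: u) x = a * rkhs_eval HK u x.
Proof. by rewrite linearZ. Qed.

Lemma rkhs_eval_le u x : `|rkhs_eval HK u x| <= `|u| * `|rkhs_section HK x|.
Proof. by rewrite rkhs_evalE; exact: rkhs_cauchy_schwarz. Qed.

Lemma rkhs_norm_section x : `|rkhs_section HK x| ^+ 2 = K x x.
Proof. by rewrite (rkhs_norm HK) -rkhs_reproducing rkhs_sectionE. Qed.

Lemma rkhs_norm_sectionB x y :
  `|rkhs_section HK x - rkhs_section HK y| ^+ 2 = K x x - 2 * K x y + K y y.
Proof.
by rewrite rkhs_normB !rkhs_norm_section -rkhs_reproducing rkhs_sectionE.
Qed.

Lemma rkhs_eval_continuous x : continuous (fun u => rkhs_eval HK u x : R).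
Proof.
move=> u; apply/cvgrPdist_le => e e0.
set k := `|rkhs_section HK x| + 1.
have k0 : 0 < k by rewrite ltr_wpDl.
near=> v; rewrite -rkhs_evalB (le_trans (rkhs_eval_le _ _))//.
have : `|u - v| <= e / k.
  by near: v; apply: cvgr_dist_le; [exact: cvg_id|rewrite divr_gt0].
rewrite ler_pdivlMr// => /(le_trans _); apply.
by rewrite ler_wpM2l// /k lerDl.
Unshelve. all: by end_near. Qed.

(** Let [p] be the point of [W] nearest to a vector [v]; it exists since the squared distance to [v]
    is strongly convex. Then [v - p] is orthogonal to every section, so it vanishes at every point,
    and [rkhs_inj] gives [v = p]. *)
Lemma rkhs_sections_total (W : set H) :
  W 0 -> (forall u v, W u -> W v -> W (u + v)) ->
  (forall a u, W u -> W (a *: u)) -> closed W ->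
  (forall x, W (rkhs_section HK x)) -> W = setT.
Proof.
move=> W0 WD WZ cW WK; apply/seteqP; split=> // v _.
have [p Wp pmin] : exists2 p, W p & forall w, W w -> `|v - p| ^+ 2 <= `|v - w| ^+ 2.
  apply: (@strongly_convex_has_min _ _ W _ 4^-1) => //.
  - by exists 0.
  - by move=> x y Wx Wy; apply: WZ; apply: WD.
  - move=> x; apply: (continuous_comp (f := fun w => `|v - w|)
      (g := fun t : R => t ^+ 2)); last exact: exprn_continuous.
    apply: (continuous_comp (f := fun w => v - w)); last exact: norm_continuous.
    by apply: continuousB => //; exact: cst_continuous.
  - move=> x y; rewrite -rkhs_parallelogram.
    have -> : v - x - (v - y) = - (x - y).
      by rewrite opprB addrC addrA subrK opprB.
    rewrite normrN [_ * 4^-1]mulrC lerD2r//.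
    suff -> : 2^-1 *: (v - x + (v - y)) = v - 2^-1 *: (x + y) by [].
    rewrite addrACA -opprD scalerDr scalerN -mulr2n -[v *+ 2]scaler_nat scalerA.
    by rewrite mulVf ?scale1r// pnatr_eq0.
suff -> : v = p by [].
apply: (@rkhs_inj _ _ _ _ HK); apply/funext => x; apply/eqP; rewrite -subr_eq0.
rewrite -[_ - _]rkhs_evalB.
set q := v - p in pmin *; set a := rkhs_eval HK q x.
(* Moving from [p] by [t] times the section at [x] stays in [W], so it cannot shorten the distance
   to [v]. *)
have h t : 2 * t * a <= t ^+ 2 * K x x.
  have /pmin : W (p + t *: rkhs_section HK x) by apply: WD => //; apply: WZ.
  rewrite opprD addrA -/q (rkhs_normB q) rkhs_dotZr -rkhs_evalE normrZ exprMn.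
  by rewrite real_normK ?num_real// rkhs_norm_section -/a; lra.
have Kx : 0 <= K x x by rewrite -rkhs_norm_section exprn_ge0.
(* With this [t] the linear term wins unless [a] is 0; adding 1 keeps the denominator positive when
   [K x x] is 0. *)
have := h (a / (K x x + 1)).
have k1 : K x x + 1 > 0 by lra.
rewrite -[_ <= _](@ler_pM2r _ ((K x x + 1) ^+ 2)) ?exprn_gt0//.
have -> : 2 * (a / (K x x + 1)) * a * (K x x + 1) ^+ 2 = 2 * a ^+ 2 * (K x x + 1).
  by field; rewrite gt_eqF.
have -> : (a / (K x x + 1)) ^+ 2 * K x x * (K x x + 1) ^+ 2 = a ^+ 2 * K x x.
  by field; rewrite gt_eqF.
have a2 := sqr_ge0 a.
move=> h'; have a0 : a ^+ 2 * (K x x + 2) <= 0 by lra.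
have : a ^+ 2 <= 0 by rewrite -(@pmulr_lle0 _ (K x x + 2))//; lra.
by rewrite le_eqVlt ltNge a2 orbF expf_eq0.
Qed.

End rkhs_theory.

(** * Powers of a measure *)

Section mimage_theory.
Local Open Scope ereal_scope.
Context d1 d2 (T1 : measurableType d1) (T2 : measurableType d2) (R : realType).
Variables (m : {measure set T1 -> \bar R}) (f : T1 -> T2).
Variable mf : measurable_fun [set: T1] f.

Lemma ge0_integral_mimage (h : T2 -> \bar R) :
  measurable_fun setT h -> (forall y, 0 <= h y) ->
  \int[mimage m mf]_y h y = \int[m]_x h (f x).
Proof.
move=> mh h0; have := @ge0_integral_pushforward _ _ _ _ R f mf m setT h.
by rewrite preimage_setT; apply.
Qed.

Lemma integrable_mimage (h : T2 -> \bar R) :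
  measurable_fun setT h -> m.-integrable setT (h \o f) ->
  (mimage m mf).-integrable setT h.
Proof.
move=> mh ih; apply/integrableP; split => //.
rewrite ge0_integral_mimage//; first by case/integrableP: ih.
exact: measurableT_comp.
Qed.

Lemma integral_mimage (h : T2 -> \bar R) :
  measurable_fun setT h ->
  \int[mimage m mf]_y h y = \int[m]_x h (f x).
Proof.
move=> mh; rewrite [LHS]integralE [RHS]integralE.
rewrite (ge0_integral_mimage (measurable_funepos mh)); last exact: funepos_ge0.
rewrite (ge0_integral_mimage (measurable_funeneg mh)); last exact: funeneg_ge0.
by congr (_ - _); apply: eq_integral => x _; rewrite ?funeposE ?funenegE.
Qed.

End mimage_theory.

Section mpower_theory.
Local Open Scope ereal_scope.
Context d (T : measurableType d) (R : realType).
Variable mu : {sigma_finite_measure set T -> \bar R}.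

Lemma tnth_tcons0 n (p : n.-tuple T * T) : tnth (tcons p) ord0 = p.2.
Proof. by []. Qed.

Lemma tnth_tconsS n (p : n.-tuple T * T) i :
  tnth (tcons p) (lift ord0 i) = tnth p.1 i.
Proof. exact: tnthS. Qed.

Lemma measurable_tbox n (A : set T) : measurable A ->
  measurable [set t : n.-tuple T | forall i, A (tnth t i)].
Proof.
move=> mA.
rewrite (_ : mkset _ = \bigcap_(i in setT) ((fun t : n.-tuple T => tnth t i) @^-1` A)).
  apply: fin_bigcap_measurable => // i _; rewrite -[X in measurable X]setTI.
  exact: measurable_tnth.
by apply/seteqP; split=> t /= h i; [move=> _|]; exact: h.
Qed.

(** Boxes with equal sides are enough for sigma-finiteness and for the total mass. *)
Lemma mpower_tbox n (A : set T) : measurable A ->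
  mpower mu n [set t : n.-tuple T | forall i, A (tnth t i)] = mu A ^+ n.
Proof.
move=> mA; elim: n => [|n IH]; first by rewrite /= diracE mem_set//= => -[].
rewrite expeS /= /mimage /pushforward/=.
rewrite (_ : _ @^-1` _ = [set t : n.-tuple T | forall i, A (tnth t i)] `*` A).
  by rewrite product_measure1E//; [rewrite IH muleC|exact: measurable_tbox].
apply/seteqP; split=> -[p z] /=.
- move=> h; split=> [i|]; last exact: (h ord0).
  by have := h (lift ord0 i); rewrite tnth_tconsS.
- move=> [h1 h2] i; case: (unliftP ord0 i) => [j|] ->; first by rewrite tnth_tconsS.
  by rewrite tnth_tcons0.
Qed.

(** The cubes over an exhaustion of [T] by sets of finite measure exhaust the power. The exhaustion
    is taken increasing, so that the finitely many coordinates of a tuple lie in a common set. *)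
Lemma sigma_finite_mpower n : sigma_finite setT (mpower mu n).
Proof.
have [F [FT ndF mF]] := (sigma_finiteP _ mu).1 (sigma_finiteT mu).
exists (fun k => [set t : n.-tuple T | forall i, F k (tnth t i)]).
  apply/seteqP; split=> // t _.
  have /choice[k kP] : forall i, exists k, F k (tnth t i).
    move=> i; have : (\bigcup_i F i) (tnth t i) by rewrite -FT.
    by case=> k _ Fk; exists k.
  exists (\max_i k i)%N => // i.
  have /subsetPset := ndF (k i) _ (@leq_bigmax _ k i).
  by apply; exact: kP.
move=> k; split; first by apply: measurable_tbox; case: (mF k).
rewrite mpower_tbox; last by case: (mF k).
have [_ Foo] := mF k; rewrite -(@fineK _ (mu (F k))) ?ge0_fin_numE//.
by rewrite -EFin_expe ltry.
Qed.

(* [mpower mu n] is the value of a coercion, on which no sigma-finite structure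
   can be declared; [mpow] carries it for Fubini's theorem. *)
Definition mpow n : set (n.-tuple T) -> \bar R := mpower mu n.

HB.instance Definition _ n := Measure.on (@mpow n).
HB.instance Definition _ n :=
  Measure_isSigmaFinite.Build _ _ _ (@mpow n) (sigma_finite_mpower n).

Lemma ge0_integral_mpowerS n (h : n.+1.-tuple T -> \bar R) :
  measurable_fun setT h -> (forall y, 0 <= h y) ->
  \int[mpower mu n.+1]_t h t =
  \int[mpower mu n]_p \int[mu]_z h (tcons (p, z)).
Proof.
move=> mh h0; rewrite /= ge0_integral_mimage//.
rewrite (@fubini_tonelli1 _ _ _ _ _ (@mpow n) mu (h \o tcons (n:=n)))//.
  by apply: measurableT_comp => //; exact: measurable_tcons.
by move=> x; exact: h0.
Qed.

(** Fubini's theorem and induction on [n]. Integrability is proved along with the value because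
    iterating the integral in the inductive step requires it. *)
Lemma integrable_mpower_prod n (h : 'I_n -> T -> R) :
  (forall i, mu.-integrable setT (EFin \o h i)) ->
  (mpower mu n).-integrable setT (fun t => (\prod_i h i (tnth t i))%:E) /\
  \int[mpower mu n]_t (\prod_i h i (tnth t i))%:E =
    \prod_i \int[mu]_z (h i z)%:E.
Proof.
elim: n h => [|n IH] h ih.
  have e : (fun t : 0.-tuple T => (\prod_i h i (tnth t i))%:E) = cst 1.
    by apply/funext => t; rewrite big_ord0.
  rewrite e /=; split.
    apply/integrableP; split => //=.
    by rewrite integral_dirac//= ?diracT ?mul1e ?normr1 ?ltey.
  by rewrite integral_dirac//= ?diracT ?mul1e big_ord0.
have mh i : measurable_fun [set: _] (h i).
  by apply/measurable_EFinP; exact: measurable_int (ih i).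
have [IH1 IH2] := IH (fun i => h (lift ord0 i)) (fun i => ih (lift ord0 i)).
have mprod k (g : 'I_k -> T -> R) : (forall i, measurable_fun setT (g i)) ->
    measurable_fun setT (fun t : k.-tuple T => (\prod_i g i (tnth t i))%R).
  move=> mg; apply: measurable_prod => i _.
  by apply: measurableT_comp => //; exact: measurable_tnth.
have mP := (measurable_EFinP _ _).2 (mprod _ _ mh).
pose F (p : n.-tuple T) := (\prod_i h (lift ord0 i) (tnth p i))%R.
have mF : measurable_fun setT F.
  by apply: (mprod n (fun i => h (lift ord0 i))) => i; exact: mh.
have prodE (p : n.-tuple T) z : (\prod_i h i (tnth (tcons (p, z)) i))%R =
    (F p * h ord0 z)%R.
  rewrite big_ord_recl mulrC tnth_tcons0; congr (_ * _)%R.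
  by apply: eq_bigr => i _; rewrite tnth_tconsS.
have mtc := measurable_tcons (T := T) (n := n).
have intP : (@mpow n \x mu).-integrable setT
    ((fun t => (\prod_i h i (tnth t i))%:E) \o tcons (n:=n)).
  apply/integrable12ltyP; first exact: measurableT_comp.
  rewrite (eq_integral (fun p => `|F p|%:E * \int[mu]_z `|(h ord0 z)%:E|)); last first.
    move=> p _; rewrite -ge0_integralZl//.
    - by apply: eq_integral => z _; rewrite /= prodE normrM EFinM.
    - by do 2 apply: measurableT_comp => //.
  have /integrableP[_ h0] := ih ord0; have /integrableP[_ Fi] := IH1.
  rewrite ge0_integralZr//; last 2 first.
  - by do 2 apply: measurableT_comp => //.
  - exact: integral_ge0.
  by apply: lte_mul_pinfty => //; [exact: integral_ge0
    |rewrite ge0_fin_numE//; exact: integral_ge0].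
split; first exact: integrable_mimage.
rewrite /= integral_mimage//.
rewrite -(@integral12_prod_meas1 _ _ _ _ _ (@mpow n) mu _ intP).
rewrite /fubini_F big_ord_recl -IH2 muleC.
rewrite (eq_integral (fun p => (F p)%:E * \int[mu]_z (h ord0 z)%:E)); last first.
  move=> p _; rewrite -(integralZl measurableT (ih ord0)).
  by apply: eq_integral => z _; rewrite /= prodE EFinM.
have /fineK <- : \int[mu]_z (h ord0 z)%:E \is a fin_num.
  by apply: integrable_fin_num => //; exact: ih.
by rewrite integralZr.
Qed.

End mpower_theory.

(** * Second moments and outer probabilities under product measures *)

Section mpower_probability.
Local Open Scope ereal_scope.
Context d (T : measurableType d) (R : realType).
Variable mu : probability T R.

Lemma mpower_setT n : mpower mu n setT = 1.
Proof.
have -> : [set: n.-tuple T] = [set t : n.-tuple T | forall i, [set: T] (tnth t i)].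
  by apply/seteqP.
rewrite mpower_tbox// [X in X ^+ _](_ : _ = 1); last exact: probability_setT.
by elim: n => // n IH; rewrite expeS IH mule1.
Qed.

Lemma measurable_sum_tnth n (phi : T -> R) : measurable_fun setT phi ->
  measurable_fun setT (fun t : n.-tuple T => (\sum_i phi (tnth t i))%R).
Proof.
move=> mphi; apply: measurable_sum => i.
by apply: measurableT_comp => //; exact: measurable_tnth.
Qed.

(** Independence kills the cross terms: with [s] the sum over the other coordinates,
    [(phi z + s) ^+ 2] integrates in the new coordinate [z] to [s ^+ 2] plus the second moment,
    since [phi] has mean 0. *)
Lemma mpower_sum_sqr (phi : T -> R) n : measurable_fun setT phi ->
  mu.-integrable setT (EFin \o phi) -> \int[mu]_z (phi z)%:E = 0 ->
  mu.-integrable setT (fun z => (phi z ^+ 2)%:E) ->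
  \int[mpower mu n]_t ((\sum_i phi (tnth t i)) ^+ 2)%:E =
    n%:R%:E * \int[mu]_z (phi z ^+ 2)%:E.
Proof.
move=> mphi iphi phi0 iphi2.
have /fineK De : \int[mu]_z (phi z ^+ 2)%:E \is a fin_num.
  exact: integrable_fin_num.
set D := fine _ in De.
have msq k : measurable_fun setT
    (fun t : k.-tuple T => ((\sum_i phi (tnth t i)) ^+ 2)%:E).
  apply/measurable_EFinP; apply: measurable_funX; exact: measurable_sum_tnth.
elim: n => [|n IH].
  by rewrite mul0e integral0_eq// => t _; rewrite big_ord0 expr0n.
rewrite ge0_integral_mpowerS//; last by move=> t; rewrite lee_fin sqr_ge0.
rewrite (eq_integral
    (fun p => ((\sum_i phi (tnth p i)) ^+ 2)%:E + D%:E)); last first.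
  move=> p _; set s := (\sum_i _)%R.
  rewrite (eq_integral (fun z => (s ^+ 2)%:E + ((2 * s)%:E * (phi z)%:E
      + (phi z ^+ 2)%:E))); last first.
    move=> z _; rewrite big_ord_recl tnth_tcons0/=.
    under eq_bigr do rewrite tnth_tconsS/=.
    by rewrite -/s -EFinM -!EFinD; congr EFin; ring.
  have i1 : mu.-integrable setT (fun z => (2 * s)%:E * (phi z)%:E).
    exact: integrableZl.
  have i2 : mu.-integrable setT (cst (s ^+ 2)%:E) by exact: finite_measure_integrable_cst.
  rewrite integralD//; last exact: integrableD.
  rewrite integralD// integralZl// phi0 mule0 add0e De integral_cst//.
  by rewrite [X in _ * X](_ : _ = 1) ?mule1//; exact: probability_setT.
have D0 : 0 <= D%:E by rewrite De; apply: integral_ge0 => z _; rewrite lee_fin sqr_ge0.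
rewrite ge0_integralD//.
- by rewrite IH integral_cst// mpower_setT mule1 -De -EFinM -EFinD -{2}(mul1r D)
    -mulrDl -natr1.
- by move=> t _; rewrite lee_fin sqr_ge0.
- exact: msq.
Qed.

Lemma mpower_mean_sqr (phi : T -> R) n : measurable_fun setT phi ->
  mu.-integrable setT (EFin \o phi) -> \int[mu]_z (phi z)%:E = 0 ->
  mu.-integrable setT (fun z => (phi z ^+ 2)%:E) ->
  \int[mpower mu n]_t ((n%:R^-1 * \sum_i phi (tnth t i)) ^+ 2)%:E =
    n%:R^-1%:E * \int[mu]_z (phi z ^+ 2)%:E.
Proof.
move=> mphi iphi phi0 iphi2.
under eq_integral do rewrite exprMn EFinM.
rewrite ge0_integralZl//; last 2 first.
- by apply/measurable_EFinP; apply: measurable_funX; exact: measurable_sum_tnth.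
- by move=> t _; rewrite lee_fin sqr_ge0.
rewrite mpower_sum_sqr// muleA -EFinM; congr (_%:E * _).
(* For [n = 0] both sides vanish, as the inverse of 0 is 0. *)
have [->|n0] := eqVneq n 0%N; first by rewrite invr0 expr0n mul0r.
by rewrite expr2 -mulrA mulVf ?mulr1// pnatr_eq0.
Qed.

Lemma mu_ext_mpower_markov n (X : n.-tuple T -> \bar R) (c : R) :
  measurable_fun setT X -> (forall t, 0 <= X t) -> (0 < c)%R ->
  mu_ext (mpower mu n) [set t | c%:E <= X t] <=
    c^-1%:E * \int[mpower mu n]_t X t.
Proof.
move=> mX X0 c0.
have mE : measurable [set t | c%:E <= X t].
  by rewrite -[X in measurable X]setTI; exact: emeasurable_fun_c_infty.
rewrite measurable_mu_extE// lee_pdivlMl//.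
have XE : (fun t => `|X t|) = X by apply/funext => t; rewrite gee0_abs.
have := @le_integral_comp_abse _ _ _ (mpower mu n) setT measurableT X c id.
have -> : [set t | c%:E <= `|X t|] = [set t | c%:E <= X t].
  by apply/seteqP; split=> t /=; rewrite gee0_abs.
rewrite setTI XE; apply => //.
Qed.

(** Convergence to 0 of the probability of an event that depends on the sample size. With the outer
    measure the events need not be measurable, and monotonicity and stability under finite unions
    are still available. *)
Definition asymptotically_null (E : forall m, set (m.-tuple T)) : Prop :=
  mu_ext (mpower mu m) (E m) @[m --> \oo] --> 0.

(** Inclusion for large [m] is enough, which leaves out [m = 0], where the regularization parameter
    is not known to be positive. *)
Lemma asymptotically_null_sub (E F : forall m, set (m.-tuple T)) :
  (\forall m \near \oo, E m `<=` F m) -> asymptotically_null F ->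
  asymptotically_null E.
Proof.
move=> EF F0; apply: (squeeze_cvge _ (cvg_cst 0) F0).
near=> m; apply/andP; split; first by apply: mu_ext_ge0 => A; exact: measure_ge0.
by apply: le_mu_ext; near: m.
Unshelve. all: by end_near. Qed.

Lemma asymptotically_nullU (E F : forall m, set (m.-tuple T)) :
  asymptotically_null E -> asymptotically_null F ->
  asymptotically_null (fun m => E m `|` F m).
Proof.
move=> E0 F0; have EF0 : mu_ext (mpower mu m) (E m) + mu_ext (mpower mu m) (F m)
    @[m --> \oo] --> 0 + 0 by apply: cvgeD.
rewrite adde0 in EF0; apply: (squeeze_cvge _ (cvg_cst 0) EF0).
near=> m; apply/andP; split; first by apply: mu_ext_ge0 => A; exact: measure_ge0.
exact: outer_measureU2.
Unshelve. all: by end_near. Qed.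

Lemma asymptotically_null_markov (X : forall m, m.-tuple T -> \bar R)
    (c : R) (B : nat -> R) :
  (forall m, measurable_fun setT (X m)) -> (forall m t, 0 <= X m t) ->
  (0 < c)%R -> (\forall m \near \oo, \int[mpower mu m]_t X m t <= (B m)%:E) ->
  (B m @[m --> \oo] --> 0)%R ->
  asymptotically_null (fun m => [set t | c%:E <= X m t]).
Proof.
move=> mX X0 c0 XB B0.
have cB0 : (c^-1 * B m)%:E @[m --> \oo] --> 0.
  by apply: cvg_EFin; [exact: nearW|rewrite -(mulr0 c^-1%R); exact: cvgMl_tmp].
apply: (squeeze_cvge _ (cvg_cst 0) cB0).
near=> m; apply/andP; split; first by apply: mu_ext_ge0 => A; exact: measure_ge0.
apply: (le_trans (mu_ext_mpower_markov _ _ c0)) => //.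
by rewrite EFinM lee_pmul2l// ?lte_fin ?invr_gt0//; near: m.
Unshelve. all: by end_near. Qed.

End mpower_probability.

(** * Tent functions and the normalized Lebesgue measure *)

Section tent.
Context {R : realType}.
Implicit Types p e x t : R.

(** The height is [e] rather than 1, so that the slopes are 1 and -1 and [tent_slope] is bounded by
    1. *)
Definition tent p e x : R := Num.max 0 (e - `|x - p|).

(* Minus the derivative of the tent, so that its integral over [x, +oo[ is
   [tent p e x]. *)
Definition tent_slope p e t : R := \1_`[p, p + e] t - \1_`[p - e, p[ t.

Lemma tent_ge0 p e x : 0 <= tent p e x.
Proof. by rewrite le_max lexx. Qed.

Lemma tent_gt0 p e x : (0 < tent p e x) = (`|x - p| < e).
Proof. by rewrite lt_max ltxx subr_gt0. Qed.

Lemma tent_le p e x : 0 <= e -> tent p e x <= e.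
Proof. by move=> e0; rewrite ge_max e0 lerBlDr lerDl normr_ge0. Qed.

Lemma tent_slope_norm p e t : `|tent_slope p e t| <= 1.
Proof.
rewrite /tent_slope !indicE; have [h|h] := boolP (t \in _);
  have [h'|h'] := boolP (t \in _); rewrite ?subrr ?subr0 ?sub0r ?normrN ?normr0 ?normr1//.
Qed.

Lemma tent_slope0 p e t : `|t - p| > e -> tent_slope p e t = 0.
Proof.
move=> h; rewrite /tent_slope !indicE !memNset ?subrr//= in_itv/=;
  by move=> /andP[h1 h2]; move: h; rewrite ltNge ler_norml; lra.
Qed.

Lemma measurable_tent_slope p e : measurable_fun setT (tent_slope p e).
Proof. by apply: measurable_funB. Qed.

(** The integrand is the difference of the indicators of the two intervals of [tent_slope], cut off
    at [x]; the difference of their lengths is the tent, for each position of [x]. *)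
Lemma integral_tent p e x : 0 < e ->
  lebesgue_measure.-integrable setT
    (EFin \o (fun t => \1_`[0, +oo[ (t - x) * tent_slope p e t)) /\
  (\int[lebesgue_measure]_t (\1_`[0%R, +oo[ (t - x) * tent_slope p e t)%:E =
    (tent p e x)%:E)%E.
Proof.
move=> e0.
pose A := `[Num.max x p, p + e]%classic : set R.
pose B := `[Num.max x (p - e), p[%classic : set R.
have fE t : \1_`[0, +oo[ (t - x) * tent_slope p e t = \1_A t - \1_B t.
  have h (P Q S : bool) : S = P && Q -> (P%:R * Q%:R = S%:R :> R).
    by move=> ->; case: P; case: Q; rewrite ?mulr1 ?mulr0.
  rewrite /tent_slope mulrBr !indicE; congr (_ - _); apply: h;
    by rewrite !mem_setE !in_itv/= subr_ge0 andbT ge_max andbA.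
have EA : (lebesgue_measure A = (Num.max 0 (p + e - Num.max x p))%:E)%E.
  rewrite /A lebesgue_measure_itv/= lte_fin.
  move: (Num.max _ _) => M; case: ltP => h; rewrite -?EFinD; congr EFin;
    [rewrite max_r//; lra|rewrite max_l//; lra].
have EB : (lebesgue_measure B = (Num.max 0 (p - Num.max x (p - e)))%:E)%E.
  rewrite /B lebesgue_measure_itv/= lte_fin.
  move: (Num.max _ _) => M; case: ltP => h; rewrite -?EFinD; congr EFin;
    [rewrite max_r//; lra|rewrite max_l//; lra].
have iI (C : set R) : measurable C -> (lebesgue_measure C < +oo)%E ->
    lebesgue_measure.-integrable setT (fun t => (\1_C t)%:E).
  move=> mC finC; apply/integrableP; split; first exact/measurable_EFinP.
  under eq_integral do rewrite gee0_abs ?lee_fin//.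
  by rewrite integral_indic// setIT.
have mA : measurable A by exact: measurable_itv.
have mB : measurable B by exact: measurable_itv.
have -> : EFin \o (fun t => \1_`[0, +oo[ (t - x) * tent_slope p e t) =
    (fun t => (\1_A t)%:E - (\1_B t)%:E)%E.
  by apply/funext => t; rewrite /= fE.
split; first by apply: integrableB => //; by apply: iI => //; rewrite ?EA ?EB ltry.
under eq_integral do rewrite fE EFinB.
rewrite integralB//; [|by apply: iI => //; rewrite EA ltry|by apply: iI => //; rewrite EB ltry].
rewrite !integral_indic// !setIT.
rewrite [X in (X - _)%E](_ : _ = lebesgue_measure A)// EA.
rewrite [X in (_ - X)%E](_ : _ = lebesgue_measure B)// EB.
rewrite -EFinB /tent; congr EFin.
have [xp|xp] := leP 0 (x - p); rewrite ?(ger0_norm xp) ?(ltr0_norm xp);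
 rewrite /Num.max; do !case: ifPn => //; rewrite -?leNgt; lra.
Qed.

End tent.
Lemma ge0_integral_mrestr d (T : measurableType d) (R : realType)
    (m : {measure set T -> \bar R}) (D : set T) (mD : measurable D)
    (f : T -> \bar R) :
  measurable_fun setT f -> (forall x, 0 <= f x)%E ->
  (\int[mrestr m mD]_x f x = \int[m]_(x in D) f x)%E.
Proof.
move=> mf f0; rewrite [LHS](@ge0_negligible_integral _ _ _ _ _ (~` D))//; last 2 first.
- exact: measurableC.
- by rewrite /= /mrestr setICl measure0.
rewrite setDE setCK setTI; apply: eq_measure_integral => A mA AD.
by rewrite /= /mrestr setIidl.
Qed.

Section normalized.
Context {R : realType} (d : nat).
Implicit Types (lo hi p x a : 'rV[R]_d) (e : R).

Local Notation leb := (@lebesgue_measure R).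

Lemma measurable_rV_prod (f : 'I_d -> R -> R) :
  (forall i, measurable_fun setT (f i)) ->
  measurable_fun setT (fun a : 'rV[R]_d => \prod_i f i (a 0 i)).
Proof.
move=> mf; apply: measurable_prod => i _.
by apply: (measurableT_comp (mf i)); exact: measurable_rV_coord.
Qed.

Lemma integral_lebesgue_rV_prod (f : 'I_d -> R -> R) :
  (forall i, leb.-integrable setT (EFin \o f i)) ->
  (@lebesgue_rV R d).-integrable setT (fun a => (\prod_i f i (a 0 i))%:E) /\
  (\int[lebesgue_rV d]_a (\prod_i f i (a 0%R i))%:E =
    \prod_i \int[leb]_t (f i t)%:E)%E.
Proof.
move=> intf.
have mf i : measurable_fun setT (f i).
  by apply/measurable_EFinP; exact: measurable_int (intf i).
have mP : measurable_fun setT (fun a : 'rV[R]_d => (\prod_i f i (a 0 i))%:E).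
  by apply/measurable_EFinP; exact: measurable_rV_prod.
have [int1 int2] := integrable_mpower_prod intf.
have fE : (fun a : 'rV[R]_d => (\prod_i f i (a 0 i))%:E) \o @rV_of_tuple R d =
    (fun t : d.-tuple (measurableTypeR R) => (\prod_i f i (tnth t i))%:E).
  by apply/funext => t /=; congr EFin; apply: eq_bigr => i _; rewrite mxE.
split.
  by apply: integrable_mimage => //; rewrite fE.
by rewrite /lebesgue_rV integral_mimage// -int2 -fE.
Qed.

(** The indicator of a rectangle is a product of indicators of intervals, so its integral
    factors. *)
Lemma lebesgue_rV_rectangle lo hi : (forall i, lo 0 i < hi 0 i) ->
  (lebesgue_rV d) (rectangle lo hi) = (\prod_i (hi 0 i - lo 0 i))%:E.
Proof.
move=> lohi.
have int1 i : leb.-integrable setT (EFin \o \1_`[lo 0 i, hi 0 i]).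
  exact: integrable_indic_itv.
have [_] := integral_lebesgue_rV_prod int1.
have -> : (fun a : 'rV[R]_d => (\prod_i (\1_`[lo 0 i, hi 0 i] (a 0 i) : R))%:E) =
    (fun a => (\1_(rectangle lo hi) a : R)%:E).
  apply/funext => a; congr EFin; rewrite [RHS]indicE.
  have [h|h] := boolP (a \in rectangle lo hi).
    rewrite big1// => i _; rewrite indicE mem_set//=.
    by move: h; rewrite inE => /(_ i); rewrite in_itv.
  have /existsNP[i hi'] : ~ (forall i, lo 0 i <= a 0 i <= hi 0 i).
    by move=> h'; move/negP: h; apply; rewrite inE.
  rewrite (bigD1 i)//= indicE memNset ?mul0r//.
rewrite integral_indic//; last exact: measurable_rectangle.
rewrite setIT => ->; rewrite -prodEFin; apply: eq_bigr => i _.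
rewrite [LHS](integral_indic leb measurableT)// setIT.
by rewrite [LHS]lebesgue_measure_itv/= lte_fin lohi.
Qed.

Lemma ge0_integral_normalized lo hi (f : 'rV[R]_d -> \bar R) :
  (forall i, lo 0 i < hi 0 i) ->
  measurable_fun setT f -> (forall a, 0 <= f a)%E ->
  (\int[normalized_lebesgue lo hi]_a f a =
   (\prod_i (hi 0%R i - lo 0%R i))^-1%:E *
     \int[lebesgue_rV d]_(a in rectangle lo hi) f a)%E.
Proof.
move=> lohi mf f0.
have v0 : 0 < \prod_i (hi 0 i - lo 0 i).
  by apply: prodr_gt0 => i _; rewrite subr_gt0.
have mQ := measurable_rectangle lo hi.
have nuE A : measurable A -> normalized_lebesgue lo hi A =
    ((lebesgue_rV d) (A `&` rectangle lo hi) *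
      (\prod_i (hi 0 i - lo 0 i))^-1%:E)%E.
  (* The rectangle has positive finite volume, so [mnormalize] is in the case where it divides by
     that volume. *)
  move=> mA; rewrite /normalized_lebesgue/= /mnormalize/= /mrestr setTI.
  by rewrite lebesgue_rV_rectangle//= eqe gt_eqF.
have iv0 : 0 <= (\prod_i (hi 0 i - lo 0 i))^-1 by rewrite invr_ge0 ltW.
rewrite -(ge0_integral_mrestr _ mQ)//.
rewrite (@eq_measure_integral _ _ _ _
  (mscale (NngNum iv0) (mrestr (lebesgue_rV d) mQ))).
  by rewrite ge0_integral_mscale.
by move=> A mA _; rewrite [LHS]nuE// /mscale/= muleC.
Qed.

Lemma integral_normalized lo hi (f : 'rV[R]_d -> \bar R) :
  (forall i, lo 0 i < hi 0 i) ->
  (@lebesgue_rV R d).-integrable setT f ->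
  (\int[normalized_lebesgue lo hi]_a f a =
   (\prod_i (hi 0%R i - lo 0%R i))^-1%:E *
     \int[lebesgue_rV d]_(a in rectangle lo hi) f a)%E.
Proof.
move=> lohi intf.
have mf := measurable_int _ intf.
have {}intf : (@lebesgue_rV R d).-integrable (rectangle lo hi) f.
  by apply: (integrableS measurableT) => //; exact: measurable_rectangle.
rewrite [LHS]integralE [X in (_ * X)%E]integralE.
rewrite (ge0_integral_normalized lohi (measurable_funepos mf))//.
rewrite (ge0_integral_normalized lohi (measurable_funeneg mf))//.
rewrite -muleBr//; apply: fin_num_adde_defl.
by rewrite fin_numN; apply: integrable_neg_fin_num => //; exact: measurable_rectangle.
Qed.

End normalized.

Section orthant_bump.
Context {R : realType} (d : nat).
Implicit Types (lo hi p x a : 'rV[R]_d) (e : R).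

(** Almost everywhere, and up to the sign (-1)^d, the mixed derivative of [bump] in all [d]
    coordinates. *)
Definition bump_density p e a : R := \prod_i tent_slope (p 0 i) e (a 0 i).

Definition bump p e x : R := \prod_i tent (p 0 i) e (x 0 i).

Lemma measurable_bump_density p e : measurable_fun setT (bump_density p e).
Proof.
by apply: (measurable_rV_prod (f := fun i => tent_slope (p 0 i) e)) => i;
  exact: measurable_tent_slope.
Qed.

Lemma bump_density_norm p e a : `|bump_density p e a| <= 1.
Proof.
rewrite normr_prod (@le_trans _ _ (\prod_(i < d) 1))//; last by rewrite big1.
apply: ler_prod => i _; rewrite normr_ge0/=; exact: tent_slope_norm.
Qed.

Lemma bump_ge0 p e x : 0 <= bump p e x.
Proof. by apply: prodr_ge0 => i _; exact: tent_ge0. Qed.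

Lemma bump_le p e x : 0 <= e -> bump p e x <= e ^+ d.
Proof.
move=> e0; rewrite -[X in e ^+ X](card_ord d) -prodr_const.
by apply: ler_prod => i _; rewrite tent_ge0 tent_le.
Qed.

Lemma bump_neq0 p e x : bump p e x != 0 -> forall i, `|x 0 i - p 0 i| < e.
Proof.
move=> h i; rewrite -tent_gt0 lt_neqAle tent_ge0 andbT eq_sym.
by move: h; rewrite /bump prodf_seq_neq0 => /allP /(_ i (mem_index_enum i)).
Qed.

(** The integrand is a product over the coordinates and vanishes outside the rectangle, which
    contains the cube around [p]. So the integral over the rectangle is one over the whole space,
    and it factors into integrals given by [integral_tent]. *)
Lemma integral_orthant_bump_density lo hi p e x : 0 < e ->
  (forall i, lo 0 i <= p 0 i - e /\ p 0 i + e <= hi 0 i) ->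
  (\int[normalized_lebesgue lo hi]_a
      (orthant_indicator a x * bump_density p e a)%:E =
    ((\prod_i (hi 0%R i - lo 0%R i))^-1 * bump p e x)%:E)%E.
Proof.
move=> e0 hp.
have lohi i : lo 0 i < hi 0 i by have [] := hp i; lra.
pose f i t := \1_`[0, +oo[ (t - x 0 i) * tent_slope (p 0 i) e t : R.
have intf i : lebesgue_measure.-integrable setT (EFin \o f i).
  by case: (integral_tent (p 0 i) (x 0 i) e0).
have [int1 int2] := integral_lebesgue_rV_prod intf.
have fE a : orthant_indicator a x * bump_density p e a = \prod_i f i (a 0 i).
  by rewrite /orthant_indicator /bump_density -big_split.
under eq_integral do rewrite fE.
rewrite integral_normalized// integral_mkcond.
have -> : (fun a : 'rV[R]_d => (\prod_i f i (a 0 i))%:E) \_ (rectangle lo hi) =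
    (fun a : 'rV[R]_d => (\prod_i f i (a 0 i))%:E).
  apply/funext => a; rewrite patchE; case: ifPn => // /negP aQ.
  have /existsNP[i ai] : ~ (forall i, lo 0 i <= a 0 i <= hi 0 i).
    by move=> h; apply: aQ; rewrite inE.
  rewrite (bigD1 i)//= /f tent_slope0 ?mulr0 ?mul0r//.
  rewrite ltNge; apply/negP; rewrite ler_norml => /andP[h1 h2]; apply: ai.
  by have [] := hp i; lra.
rewrite int2 EFinM; congr (_ * _)%E.
rewrite /bump -prodEFin; apply: eq_bigr => i _.
by have [_ ->] := integral_tent (p 0 i) (x 0 i) e0.
Qed.

End orthant_bump.

(** * Regularity of the functions of the space *)

Section mercer_kernel.
Context {R : realType} {d : nat} {X : set 'rV[R]_d} {K : X -> X -> R}.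
Hypothesis hK : smooth_mercer_kernel K.
Context {H : completeNormedModType R} (HK : rkhs K H).

(** The squared distance is K(x,x) - 2 K(x,c) + K(c,c), which tends to 0 by continuity of a local
    extension [F] of the kernel. Neighbourhoods are taken in the ambient space. *)
Lemma rkhs_section_near (c : X) (eta : R) : 0 < eta ->
  \forall v \near \val c, forall x : X, \val x = v ->
    `|rkhs_section HK x - rkhs_section HK c| <= eta.
Proof.
move=> eta0; have [Ksm Ksym _] := hK.
have [U [F [oU Uc smF KF]]] := Ksm c c.
have [cF _] := smF 0%N.
have {}cF := cF _ Uc.
(* One third, as K(x,x) enters once and K(x,c) twice. *)
have e0 : 0 < eta ^+ 2 / 3 by rewrite divr_gt0// exprn_gt0.
have [[A B] [nA nB] AB] : nbhs (\val c, \val c)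
    [set w | U w /\ `|F (\val c, \val c) - F w| < eta ^+ 2 / 3].
  apply: filterI; first by move: (open_nbhs_nbhs (conj oU Uc)).
  by have /cvgrPdist_lt /(_ _ e0) := cF.
near=> v => x xv.
have Av : A (\val x) by rewrite xv; near: v.
have Bv : B (\val x) by rewrite xv; near: v.
have Bc : B (\val c) by exact: nbhs_singleton.
have Ac : A (\val c) by exact: nbhs_singleton.
have [U1 F1] := AB (\val x, \val x) (conj Av Bv).
have [U2 F2] := AB (\val x, \val c) (conj Av Bc).
rewrite -(@ler_pXn2r _ 2) ?nnegrE ?(ltW eta0)// rkhs_norm_sectionB.
rewrite (KF x x U1) (KF x c U2) (KF c c Uc).
by move: F1 F2; rewrite !ltr_norml => /andP[? ?] /andP[? ?]; lra.
Unshelve. all: by end_near. Qed.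

Lemma rkhs_eval_near (f : H) (c : X) (eta : R) : 0 < eta ->
  \forall v \near \val c, forall x : X, \val x = v ->
    `|rkhs_eval HK f x - rkhs_eval HK f c| <= eta.
Proof.
move=> eta0; have f1 : 0 < `|f| + 1 by rewrite ltr_wpDl.
have e0 : 0 < eta / (`|f| + 1) by rewrite divr_gt0.
near=> v => x xv.
have h : `|rkhs_section HK x - rkhs_section HK c| <= eta / (`|f| + 1).
  by move: x xv; near: v; exact: rkhs_section_near.
rewrite !rkhs_evalE -linearBr (le_trans (rkhs_cauchy_schwarz _ _ _))//.
move: h; rewrite ler_pdivlMr// mulrC => /(le_trans _); apply.
by rewrite ler_wpM2r// lerDl.
Unshelve. all: by end_near. Qed.

Lemma rkhs_eval_bounded (hX : compact X) (f : H) :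
  exists B, forall x, `|rkhs_eval HK f x| <= B.
Proof.
have /compact_near_coveringP cX := hX.
(* Near a point [c], every [B] above |f(c)| + 1 is a bound; compactness makes this uniform for all
   large [B]. *)
have [B [_ HB]] : \forall B \near +oo, X `<=`
    (fun v => forall x : X, \val x = v -> `|rkhs_eval HK f x| <= B).
  apply: cX => v Xv.
  pose c : X := SigSub (mem_set Xv).
  exists ([set v | forall x : X, \val x = v -> `|rkhs_eval HK f x - rkhs_eval HK f c| <= 1],
      [set B | `|rkhs_eval HK f c| + 1 < B]).
    split=> /=; first exact: (@rkhs_eval_near f c 1).
    by apply: nbhs_pinfty_gt; rewrite num_real.
  move=> [w B] /= [h1 h2] x xw.
  rewrite (le_trans _ (ltW h2))// -[X in `|X| <= _](subrK (rkhs_eval HK f c)).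
  by rewrite (le_trans (ler_normD _ _))// addrC lerD2l h1.
exists (B + 1) => x; apply: (HB (B + 1)) => //; first by rewrite ltrDl.
exact: set_valP.
Qed.

End mercer_kernel.

Section borel_sub_theory.
Context {R : realType} {d : nat} {X : set 'rV[R]_d} (X0 : X !=set0).

(** Such a set is the trace on [X] of an open set: the interior of the set of vectors that are in
    [A] or outside [X]. *)
Lemma measurable_rel_open (A : set (borel_sub X0)) :
  (forall x, A x -> \forall v \near \val (x : X),
    forall x' : X, \val x' = v -> A x') -> measurable A.
Proof.
move=> hA; apply: sub_sigma_algebra.
exists (interior [set v | forall x' : X, \val x' = v -> A x']).
  exact: open_interior.
apply/seteqP; split=> x /=; last exact: hA.
by move=> /interior_subset /(_ x erefl).
Qed.

Lemma measurable_fun_borel_sub (f : borel_sub X0 -> R) :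
  (forall (x : X) (eta : R), 0 < eta -> \forall v \near \val x,
    forall x' : X, \val x' = v -> `|f x' - f x| <= eta) ->
  measurable_fun setT f.
Proof.
move=> hf; apply: (measurability _ (RGenOInfty.measurableE R)) => _ [_ [r ->] <-].
rewrite setTI; apply: measurable_rel_open => x /=; rewrite in_itv/= andbT => rx.
have e0 : 0 < (f x - r) / 2 by rewrite divr_gt0// subr_gt0.
near=> v => x' xv; rewrite /= in_itv/= andbT.
have : `|f x' - f x| <= (f x - r) / 2 by move: x' xv; near: v; exact: hf.
by rewrite ler_norml => /andP[? ?]; lra.
Unshelve. all: by end_near. Qed.

Lemma measurable_borel_sub_coord i :
  measurable_fun setT (fun x : borel_sub X0 => \val (x : X) 0 i).
Proof.
apply: measurable_fun_borel_sub => x eta eta0.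
have := @coord_continuous R 1 d 0 i (\val x).
move=> /cvgrPdist_le /(_ _ eta0); apply: filterS => v /= h x' xv.
by rewrite distrC xv.
Qed.

End borel_sub_theory.

(** * Regression functions *)

Section constant_kernels.
Local Open Scope ereal_scope.
Context d1 d2 (T1 : measurableType d1) (T2 : measurableType d2) (R : realType).

(** A measure on [T1] seen as a kernel from a one-point space. Its composition with [ksnd k] is the
    mixture of the measures [k x], and [integral_kcomp] becomes a formula for integrals against this
    mixture. *)
Definition kconst (m : {finite_measure set T1 -> \bar R}) (_ : unit) :
  {measure set T1 -> \bar R} := m.

HB.instance Definition _ m :=
  isKernel.Build _ _ unit T1 R (kconst m) (fun U _ => measurable_cst (m U)).

Let kconst_uub m : measure_fam_uub (kconst m).
Proof.
exists (fine (m setT) + 1)%R => x; change (m setT < (fine (m setT) + 1)%:E).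
rewrite EFinD fineK ?fin_num_measure//.
by rewrite lteDl ?lte_fin// fin_num_measure.
Qed.

HB.instance Definition _ m :=
  Kernel_isFinite.Build _ _ unit T1 R (kconst m) (kconst_uub m).

Definition ksnd (k : R.-pker T1 ~> T2) (x : unit * T1) :
  {measure set T2 -> \bar R} := k x.2.

Let measurable_ksnd k U : measurable U -> measurable_fun setT (ksnd k ^~ U).
Proof.
move=> mU; have mk := measurable_kernel k U mU.
by apply: (@measurableT_comp _ _ _ _ _ _ (k ^~ U) _ snd).
Qed.

HB.instance Definition _ k :=
  isKernel.Build _ _ (unit * T1)%type T2 R (ksnd k) (measurable_ksnd k).

Let ksnd_setT k x : ksnd k x setT = 1.
Proof. exact: prob_kernel. Qed.

HB.instance Definition _ k :=
  Kernel_isProbability.Build _ _ (unit * T1)%type T2 R (ksnd k) (ksnd_setT k).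

End constant_kernels.

Section mimage_finite.
Context d1 d2 (T1 : measurableType d1) (T2 : measurableType d2) (R : realType).
Variables (m : {finite_measure set T1 -> \bar R}) (f : T1 -> T2).
Variable mf : measurable_fun [set: T1] f.

Let fin_num_mimage : fin_num_fun (mimage m mf).
Proof.
move=> U mU; apply: fin_num_measure; rewrite -[X in measurable X]setTI.
exact: mf.
Qed.

HB.instance Definition _ :=
  Measure_isFinite.Build _ _ _ (mimage m mf) fin_num_mimage.

End mimage_finite.

Section regression.
Context {R : realType} {d : nat} {X : set 'rV[R]_d} (X0 : X !=set0).
Context {dY : measure_display} {Y : measurableType dY}.

Local Notation Z := (borel_sub X0 * Y)%type.
Variable mu : probability Z R.
Implicit Types (a : 'rV[R]_d) (f : borel_sub X0 -> R) (g : Y -> R).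

Lemma ge0_integral_marginalY (h : Y -> \bar R) :
  measurable_fun setT h -> (forall x, 0 <= h x)%E ->
  (\int[marginalY mu]_x h x = \int[mu]_z h z.2)%E.
Proof. by move=> mh h0; exact: (ge0_integral_mimage mu measurable_snd). Qed.

Lemma integrable_marginalY g : measurable_fun setT g ->
  (marginalY mu).-integrable setT (EFin \o g) ->
  mu.-integrable setT (fun z => (g z.2)%:E).
Proof.
move=> mg /integrableP[_ ig]; apply/integrableP; split.
  by apply/measurable_EFinP; exact: measurableT_comp.
rewrite -(ge0_integral_marginalY (h := fun y => `|(g y)%:E|%E))//.
by apply: measurableT_comp => //; exact/measurable_EFinP.
Qed.

(** The restriction of [mu] to the sets over [A], pushed to [Y], is the mixture of the [k x] under
    the marginal restricted to [A]: on each measurable set this is the definition of a regular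
    conditional probability. *)
Lemma ge0_integral_disintegration (k : R.-pker borel_sub X0 ~> Y)
    (A : set (borel_sub X0)) (G : Y -> \bar R) :
  regular_conditional_probability mu k -> measurable A ->
  measurable_fun setT G -> (forall y, 0 <= G y)%E ->
  (\int[mu]_(z in A `*` setT) G z.2 =
    \int[marginalX mu]_(x in A) \int[k x]_y G y)%E.
Proof.
move=> hk mA mG G0.
have mAY : measurable (A `*` [set: Y]) by exact: measurableX.
have mkG : measurable_fun setT (fun x => \int[k x]_y G y)%E.
  by apply: measurable_fun_integral_kernel => // U mU; exact: measurable_kernel.
pose mX : {finite_measure set (borel_sub X0) -> \bar R} :=
  mimage mu (@measurable_fst _ _ (borel_sub X0) Y).
have := @integral_kcomp _ _ _ _ _ _ R (kconst (mrestr mX mA)) (ksnd k) tt G G0 mG.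
rewrite (_ : (fun y => _) = fun x => (\int[k x]_y G y)%E)//.
rewrite [X in _ = X -> _](_ : _ =
    \int[marginalX mu]_(x in A) \int[k x]_y G y)%E; last first.
  by rewrite /kconst ge0_integral_mrestr// => x; exact: integral_ge0.
move=> <-.
rewrite -(@ge0_integral_mrestr _ _ _ mu _ mAY (fun z => G z.2))//; last first.
  exact: measurableT_comp.
rewrite -(ge0_integral_mimage _ measurable_snd mG G0).
apply: eq_measure_integral => B mB _.
rewrite /= /kcomp /mimage /pushforward /kconst /=.
rewrite ge0_integral_mrestr//.
- rewrite -hk// /mrestr; congr (mu _); apply/seteqP; split=> -[x y] /=; tauto.
- exact: measurable_kernel.
Qed.

End regression.

Section residual.
Context {R : realType} {d : nat} {X : set 'rV[R]_d} (X0 : X !=set0).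
Context {dY : measure_display} {Y : measurableType dY}.

Local Notation Z := (borel_sub X0 * Y)%type.
Variable mu : probability Z R.
Variables (k : R.-pker borel_sub X0 ~> Y) (g : Y -> R) (f : borel_sub X0 -> R).
Hypothesis hk : regular_conditional_probability mu k.
Hypothesis mg : measurable_fun setT g.
Hypothesis ig : mu.-integrable setT (fun z => (g z.2)%:E).
Hypothesis mf : measurable_fun setT f.
Hypothesis if1 : mu.-integrable setT (fun z => (f z.1)%:E).
Hypothesis fE : \forall x \ae marginalX mu, (f x)%:E = (\int[k x]_y (g y)%:E)%E.

Local Open Scope ereal_scope.

(** The disintegration formula is applied to the positive and negative parts of [g]; both have
    finite integrals, so their difference may be taken under the outer integral. *)
Lemma integral_conditional_expectation (A : set (borel_sub X0)) : measurable A ->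
  \int[mu]_(z in A `*` setT) (g z.2)%:E = \int[mu]_(z in A `*` setT) (f z.1)%:E.
Proof.
move=> mA; have mAY : measurable (A `*` [set: Y]) by exact: measurableX.
pose mX : {finite_measure set (borel_sub X0) -> \bar R} :=
  mimage mu (@measurable_fst _ _ (borel_sub X0) Y).
have mG : measurable_fun setT (EFin \o g) by exact/measurable_EFinP.
have mGp := measurable_funepos mG; have mGn := measurable_funeneg mG.
have mI (G : Y -> \bar R) : measurable_fun setT G -> (forall y, 0 <= G y) ->
    measurable_fun setT (fun x => \int[k x]_y G y).
  by move=> mG' G0; apply: measurable_fun_integral_kernel => // U mU;
    exact: measurable_kernel.
have iI (G : Y -> \bar R) : measurable_fun setT G -> (forall y, 0 <= G y) ->
    \int[mu]_z G z.2 < +oo -> mX.-integrable A (fun x => \int[k x]_y G y).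
  move=> mG' G0 Goo; apply: (integrableS measurableT) => //.
  apply/integrableP; split; first exact: mI.
  rewrite (eq_integral (fun x => \int[k x]_y G y)); last first.
    by move=> x _; apply: gee0_abs; apply: integral_ge0 => y _; exact: G0.
  by have := ge0_integral_disintegration hk measurableT mG' G0; rewrite setXTT => <-.
have /integrableP[mg2 igoo] := ig.
have Gpoo : \int[mu]_z (EFin \o g)^\+ z.2 < +oo.
  apply: le_lt_trans igoo; apply: ge0_le_integral => //.
  - exact: measurableT_comp.
  - exact: measurableT_comp.
  - by move=> z _; rewrite -/((abse \o (EFin \o g)) z.2) fune_abse leeDl.
have Gnoo : \int[mu]_z (EFin \o g)^\- z.2 < +oo.
  apply: le_lt_trans igoo; apply: ge0_le_integral => //.
  - exact: measurableT_comp.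
  - exact: measurableT_comp.
  - by move=> z _; rewrite -/((abse \o (EFin \o g)) z.2) fune_abse leeDr.
rewrite [LHS]integralE.
rewrite (eq_integral (fun z : Z => (EFin \o g)^\+ z.2)); last first.
  by move=> z _; rewrite !funeposE.
rewrite [X in _ - X](eq_integral (fun z : Z => (EFin \o g)^\- z.2)); last first.
  by move=> z _; rewrite !funenegE.
rewrite !(ge0_integral_disintegration hk mA)//.
rewrite -[LHS](@integralB _ _ _ mX)//; [|exact: iI|exact: iI].
transitivity (\int[mX]_(x in A) (f x)%:E); last first.
  rewrite integral_mkcond [RHS]integral_mkcond.
  rewrite [LHS]integral_mimage; last first.
    apply/(measurable_restrictT _ mA); apply: measurable_funTS.
    exact/measurable_EFinP.
  apply: eq_integral => z _; rewrite !patchE.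
  by congr (if _ then _ else _); apply/idP/idP; rewrite !inE => // -[].
apply: ae_eq_integral => //.
- apply: measurable_funTS; apply: emeasurable_funB; exact: mI.
- by apply: measurable_funTS; exact/measurable_EFinP.
- have fE' : \forall x \ae mX, (f x)%:E = \int[k x]_y (g y)%:E by exact: fE.
  apply: filterS fE' => x -> _; rewrite [RHS]integralE.
  by congr (_ - _); apply: eq_integral => y _; rewrite ?funeposE ?funenegE.
Qed.

(** Applied later to lower orthants [A], this makes the terms of A r - B centered. *)
Lemma integral_residual (A : set (borel_sub X0)) : measurable A ->
  \int[mu]_z (\1_A z.1 * (f z.1 - g z.2))%:E = 0.
Proof.
move=> mA; have mAY : measurable (A `*` [set: Y]) by exact: measurableX.
rewrite (eq_integral ((fun z : Z => (f z.1)%:E - (g z.2)%:E) \_ (A `*` setT))).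
  rewrite -integral_mkcond integralB//; try exact: integrableS measurableT _ _ _.
  rewrite integral_conditional_expectation// subee//.
  apply: integrable_fin_num => //; exact: (integrableS measurableT).
move=> z _; rewrite patchE indicE.
have -> : (z \in A `*` [set: Y]) = (z.1 \in A).
  by apply/idP/idP; rewrite !inE => // -[].
by case: ifPn => _; rewrite (mul0r,mul1r).
Qed.

End residual.

(** * The minimizer of the objective *)

Section orthant.
Context {R : realType} (d : nat).
Implicit Types (a x : 'rV[R]_d).

Lemma orthant_indicatorE a x :
  orthant_indicator a x = \1_[set x : 'rV[R]_d | forall i, x 0 i <= a 0 i] x.
Proof.
rewrite /orthant_indicator indicE.
have [h|h] := boolP (x \in [set x : 'rV[R]_d | forall i, x 0 i <= a 0 i]).
  rewrite big1// => i _; rewrite indicE mem_set//= in_itv/= andbT subr_ge0.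
  by move: h; rewrite inE.
have /existsNP[i hi] : ~ (forall i, x 0 i <= a 0 i).
  by move=> h'; move/negP: h; apply; rewrite inE.
rewrite (bigD1 i)//= indicE memNset ?mul0r//=. rewrite in_itv/= andbT subr_ge0.
exact: hi.
Qed.

Lemma orthant_indicator_ge0 a x : 0 <= orthant_indicator a x.
Proof. by apply: prodr_ge0 => i _; rewrite indicE. Qed.

Lemma orthant_indicator_le1 a x : orthant_indicator a x <= 1.
Proof. by rewrite orthant_indicatorE indicE lern1 leq_b1. Qed.

Lemma measurable_orthant_indicator d' (T : measurableType d')
    (f h : T -> 'rV[R]_d) :
  (forall i, measurable_fun setT (fun t => f t 0 i)) ->
  (forall i, measurable_fun setT (fun t => h t 0 i)) ->
  measurable_fun setT (fun t => orthant_indicator (f t) (h t)).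
Proof.
move=> mf mh; apply: measurable_prod => i _.
apply: (@measurableT_comp _ _ _ _ _ _ (\1_`[0, +oo[ : R -> R)) => //.
exact: measurable_funB.
Qed.

End orthant.

Lemma bounded_integrable d (T : measurableType d) (R : realType)
    (mu : probability T R) (f : T -> R) (C : R) :
  measurable_fun setT f -> (forall x, `|f x| <= C) ->
  mu.-integrable setT (EFin \o f).
Proof.
move=> mf fC; apply/integrableP; split; first exact/measurable_EFinP.
apply: (@le_lt_trans _ _ (\int[mu]_x C%:E)%E); last first.
  by rewrite integral_cst// [X in (_ * X)%E](_ : _ = 1%E) ?mule1 ?ltry//; exact: probability_setT.
apply: ge0_le_integral => //.
- by apply: measurableT_comp => //; exact/measurable_EFinP.
- by move=> x _; rewrite lee_fin.
Qed.

(** * Averages of orthant indicators over a sample *)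

Section smear.
Context {R : realType} (d : nat) (nu : probability 'rV[R]_d R).
Context (m : nat) (x : 'I_m -> 'rV[R]_d).
Implicit Types (v w : 'I_m -> R) (a : 'rV[R]_d) (h : 'rV[R]_d -> R).

(** The common form of [empirical_op], [empirical_rhs] and their difference, for arbitrary real
    weights [v] at the sample points. *)
Definition smear v a : R := m%:R^-1 * \sum_i orthant_indicator a (x i) * v i.

Definition smear_sqr v : R := \int[nu]_a (smear v a ^+ 2).

Lemma measurable_smear v : measurable_fun setT (smear v).
Proof.
apply: measurable_funM => //; apply: measurable_sum => i.
apply: measurable_funM => //; apply: measurable_orthant_indicator => j //.
exact: measurable_rV_coord.
Qed.

Lemma smear_norm v a : `|smear v a| <= m%:R^-1 * \sum_i `|v i|.
Proof.
rewrite /smear normrM ger0_norm ?invr_ge0// ler_wpM2l ?invr_ge0//.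
apply: le_trans (ler_norm_sum _ _ _) _; apply: ler_sum => i _.
rewrite normrM ger0_norm ?orthant_indicator_ge0//.
by rewrite ler_piMl// orthant_indicator_le1.
Qed.

Lemma integrable_smearM v h : measurable_fun setT h -> (forall a, `|h a| <= 1) ->
  nu.-integrable setT (EFin \o (fun a => smear v a * h a)).
Proof.
move=> mh h1; apply: (bounded_integrable _ (C := m%:R^-1 * \sum_i `|v i|)).
  by apply: measurable_funM => //; exact: measurable_smear.
by move=> a; rewrite normrM -[leRHS]mulr1 ler_pM// smear_norm.
Qed.

Lemma integrable_smear2 v w :
  nu.-integrable setT (EFin \o (fun a => smear v a * smear w a)).
Proof.
apply: (bounded_integrable _
  (C := (m%:R^-1 * \sum_i `|v i|) * (m%:R^-1 * \sum_i `|w i|))).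
  by apply: measurable_funM; exact: measurable_smear.
by move=> a; rewrite normrM ler_pM// smear_norm.
Qed.

Lemma integrable_smear_sqr v :
  nu.-integrable setT (EFin \o (fun a => smear v a ^+ 2)).
Proof. exact: integrable_smear2. Qed.

Lemma smear_sqrE v :
  (\int[nu]_a (smear v a ^+ 2)%:E = (smear_sqr v)%:E)%E.
Proof. by rewrite /smear_sqr /Rintegral fineK// integrable_fin_num// integrable_smear_sqr. Qed.

Lemma smear_sqr_ge0 v : 0 <= smear_sqr v.
Proof. by apply: Rintegral_ge0 => a _; exact: sqr_ge0. Qed.

(** Carries pointwise quadratic inequalities, such as convexity of the square, over to the
    integrals. *)
Lemma smear_sqr_le2 v w u (p q : R) :
  (forall a, smear u a ^+ 2 <= p * smear v a ^+ 2 + q * smear w a ^+ 2) ->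
  smear_sqr u <= p * smear_sqr v + q * smear_sqr w.
Proof.
move=> huvw; rewrite /smear_sqr -!RintegralZl//; try exact: integrable_smear_sqr.
have iZ r z : nu.-integrable setT (EFin \o (fun a => r * smear z a ^+ 2)).
  rewrite (_ : _ \o _ = (fun a => r%:E * (smear z a ^+ 2)%:E)%E)//.
  by apply: integrableZl => //; exact: integrable_smear_sqr.
rewrite -RintegralD//; apply: le_Rintegral => //.
  exact: integrable_smear_sqr.
rewrite (_ : _ \o _ = (fun a => (p * smear v a ^+ 2)%:E + (q * smear w a ^+ 2)%:E)%E)//.
by apply: integrableD => //; exact: iZ.
Qed.

Lemma smear_lin (p q : R) v w a :
  smear (fun i => p * v i + q * w i) a = p * smear v a + q * smear w a.
Proof.
rewrite /smear !mulr_sumr -big_split/=; apply: eq_bigr => i _; ring.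
Qed.

(** A quadratic form written with its Gram matrix, so that continuity in the finitely many weights
    is evident. *)
Lemma smear_sqr_double v :
  smear_sqr v = m%:R^-1 ^+ 2 * \sum_i \sum_j v i * v j *
    \int[nu]_a (orthant_indicator a (x i) * orthant_indicator a (x j)).
Proof.
have iI i j : nu.-integrable setT
    (EFin \o (fun a => orthant_indicator a (x i) * orthant_indicator a (x j))).
  apply: (bounded_integrable _ (C := 1)).
    by apply: measurable_funM; apply: measurable_orthant_indicator => // k;
      exact: measurable_rV_coord.
  move=> a; rewrite normrM !ger0_norm ?orthant_indicator_ge0//.
  by rewrite mulr_ile1 ?orthant_indicator_ge0 ?orthant_indicator_le1.
apply: EFin_inj; rewrite -smear_sqrE.
rewrite (eq_integral (fun a => \sum_i \sum_j (m%:R^-1 ^+ 2 * (v i * v j))%:E *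
    (orthant_indicator a (x i) * orthant_indicator a (x j))%:E)%E); last first.
  move=> a _; rewrite /smear exprMn expr2 [X in _ * X]expr2 mulr_suml mulr_sumr.
  rewrite -sumEFin; apply: eq_bigr => i _.
  rewrite mulr_sumr mulr_sumr -sumEFin; apply: eq_bigr => j _.
  by rewrite -EFinM; congr EFin; ring.
have iIZ i j : nu.-integrable setT (fun a => (m%:R^-1 ^+ 2 * (v i * v j))%:E *
    (orthant_indicator a (x i) * orthant_indicator a (x j))%:E)%E.
  by apply: integrableZl => //; exact: iI.
rewrite integral_sum//; last by move=> i; apply: integrable_sum.
rewrite mulr_sumr -sumEFin; apply: eq_bigr => i _.
rewrite integral_sum// mulr_sumr -sumEFin; apply: eq_bigr => j _.
rewrite integralZl//; last exact: iI.
by rewrite [in RHS]mulrA [RHS]EFinM /Rintegral fineK// integrable_fin_num//; exact: iI.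
Qed.

(** Pointwise |s| <= s^2 / (2 t) + t / 2, by completing a square. The free parameter [t] replaces
    the square root in the Cauchy-Schwarz inequality. *)
Lemma smear_pairing v h (t : R) : 0 < t ->
  measurable_fun setT h -> (forall a, `|h a| <= 1) ->
  `|\int[nu]_a (smear v a * h a)| <= (smear_sqr v / t + t) / 2.
Proof.
move=> t0 mh h1.
have iZ : nu.-integrable setT (EFin \o (fun a => (2 * t)^-1 * smear v a ^+ 2)).
  rewrite (_ : _ \o _ = (fun a => (2 * t)^-1%:E * (smear v a ^+ 2)%:E)%E)//.
  by apply: integrableZl => //; exact: integrable_smear_sqr.
have ic : nu.-integrable setT (EFin \o cst (t / 2)).
  by apply: (bounded_integrable _ (C := `|t / 2|)).
have -> : (smear_sqr v / t + t) / 2 =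
    \int[nu]_a ((2 * t)^-1 * smear v a ^+ 2 + t / 2).
  rewrite RintegralD// (RintegralZl _ measurableT (integrable_smear_sqr v)).
  rewrite Rintegral_cst// [X in fine X](probability_setT nu)/= mulr1 -/(smear_sqr v).
  by field; rewrite gt_eqF.
apply: le_trans (le_normr_Rintegral _ _) _ => //; first exact: integrable_smearM.
apply: le_Rintegral => //.
- rewrite (_ : _ \o _ = abse \o (EFin \o (fun a => smear v a * h a)))//.
  by apply: integrable_abse; exact: integrable_smearM.
- rewrite (_ : _ \o _ = (fun a => ((2 * t)^-1 * smear v a ^+ 2)%:E + (t / 2)%:E)%E)//.
  exact: integrableD.
- move=> a _; rewrite normrM.
  apply: (@le_trans _ _ `|smear v a|); first by rewrite ler_piMr.
  have e : (2 * t)^-1 * smear v a ^+ 2 + t / 2 - `|smear v a| =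
      (2 * t)^-1 * (`|smear v a| - t) ^+ 2.
    rewrite -(real_normK (num_real (smear v a))).
    by field; rewrite gt_eqF.
  by rewrite -subr_ge0 e mulr_ge0 ?sqr_ge0// invr_ge0 mulr_ge0// ltW.
Qed.

End smear.

Section minimizer.
Context {R : realType} {d : nat} {X : set 'rV[R]_d} (X0 : X !=set0).
Context {dY : measure_display} {Y : measurableType dY}.
Context {K : X -> X -> R} {H : completeNormedModType R} (HK : rkhs K H).
Variables (g : Y -> R) (lo hi : 'rV[R]_d) (c : R).
Hypothesis c0 : 0 < c.

Local Notation Z := (borel_sub X0 * Y)%type.

Variables (m : nat) (S : m.-tuple Z).

Definition sample_point (i : 'I_m) : 'rV[R]_d := \val ((tnth S i).1 : X).

Definition sample_residual (f : H) (i : 'I_m) : R :=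
  rkhs_eval HK f (tnth S i).1 - g (tnth S i).2.

Definition sample_eval (f : H) (i : 'I_m) : R := rkhs_eval HK f (tnth S i).1.

Local Notation nu := (normalized_lebesgue lo hi).
Local Notation sq := (smear_sqr nu sample_point).

Definition risk (f : H) : R := sq (sample_residual f) + c * `|f| ^+ 2.

Lemma objectiveE (f : H) : objective HK g lo hi c S f = (risk f)%:E.
Proof.
rewrite /objective.
have fE a : empirical_op HK S f a - empirical_rhs g S a =
    smear sample_point (sample_residual f) a.
  rewrite /empirical_op /empirical_rhs /smear -mulrBr -sumrB; congr (_ * _).
  by apply: eq_bigr => i _; rewrite -mulrBr.
have NE : ('N[nu]_2%:E
    [EFin \o (fun a => empirical_op HK S f a - empirical_rhs g S a)%R] =
    (sq (sample_residual f) `^ 2^-1)%:E)%E.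
  rewrite unlock -poweR_EFin -smear_sqrE; congr (_ `^ _)%E.
  apply: eq_integral => a _ /=; rewrite fE.
  by rewrite ?poweR_EFin powR_mulrn// real_normK ?num_real.
rewrite NE EFinD; congr (_ + _)%E.
by rewrite -EFin_expe powR12_sqrt ?smear_sqr_ge0// sqr_sqrtr ?smear_sqr_ge0.
Qed.

(** The residual term is convex, and the parallelogram law makes the penalty strongly convex, whence
    the constant [c / 4]. *)
Lemma risk_midpoint f f' :
  risk (2^-1 *: (f + f')) + c / 4 * `|f - f'| ^+ 2 <= (risk f + risk f') / 2.
Proof.
have h : sq (sample_residual (2^-1 *: (f + f'))) <=
    2^-1 * sq (sample_residual f) + 2^-1 * sq (sample_residual f').
  apply: smear_sqr_le2 => a.
  have -> : sample_residual (2^-1 *: (f + f')) =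
      fun i => 2^-1 * sample_residual f i + 2^-1 * sample_residual f' i.
    apply/funext => i; rewrite /sample_residual rkhs_evalZ rkhs_evalD.
    by field.
  rewrite smear_lin.
  have := sqr_ge0 (smear sample_point (sample_residual f) a -
                   smear sample_point (sample_residual f') a).
  by rewrite !expr2; lra.
rewrite /risk; have /= := rkhs_parallelogram HK f f'.
set A := `|2^-1 *: (f + f')| ^+ 2; set B := `|f - f'| ^+ 2 => AB.
have : c * A + c / 4 * B = c * ((`|f| ^+ 2 + `|f'| ^+ 2) / 2).
  by rewrite -AB; field.
by lra.
Qed.

(** The residual term depends on [f] only through its values at the [m] sample points, and
    evaluations are continuous. *)
Lemma risk_continuous : continuous risk.
Proof.
move=> f; apply: cvgD; last first.
  apply: cvgMl_tmp; apply: (continuous_comp (f := fun w : H => `|w|)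
      (g := fun t : R => t ^+ 2)); [exact: norm_continuous|exact: exprn_continuous].
rewrite smear_sqr_double.
under eq_cvg do rewrite smear_sqr_double.
have cr i : sample_residual f' i @[f' --> f] --> sample_residual f i.
  by apply: cvgB; [exact: rkhs_eval_continuous|exact: cvg_cst].
apply: cvgMl_tmp; apply: cvg_big => [|i _]; first exact: add_continuous.
apply: cvg_big => [|j _]; first exact: add_continuous.
by apply: cvgMr_tmp; exact: cvgM.
Qed.

(** [get] returns a true minimizer because one exists, by strong convexity and completeness. *)
Lemma minimizer_le (f : H) :
  risk (minimizer HK g lo hi c S) <= risk f.
Proof.
have [f0 _ f0min] : exists2 f0, setT f0 & forall f, setT f -> risk f0 <= risk f.
  apply: (@strongly_convex_has_min _ _ _ _ (c / 4)) => //.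
  - by exists 0.
  - by rewrite divr_gt0.
  - by move=> f1; rewrite addr_ge0 ?smear_sqr_ge0// mulr_ge0 ?(ltW c0)//.
  - exact: risk_continuous.
  - by move=> f1 f2; exact: risk_midpoint.
have : [set f : H | forall f', (objective HK g lo hi c S f <=
    objective HK g lo hi c S f')%E] (minimizer HK g lo hi c S).
  apply: getPex; exists f0 => f'; rewrite !objectiveE lee_fin; exact: f0min.
by move=> /(_ f); rewrite !objectiveE lee_fin.
Qed.

Variable r : H.
Local Notation u := (minimizer HK g lo hi c S - r).
Local Notation e := (sq (sample_residual r)).

(* All the bounds on the error come from comparing the risks of the minimizer
   and of [r]. *)
Let minimizer_base :
  sq (sample_residual (minimizer HK g lo hi c S)) +
    c * `|minimizer HK g lo hi c S| ^+ 2 <= e + c * `|r| ^+ 2.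
Proof. exact: minimizer_le. Qed.

Let norm_minimizer_sqr :
  `|minimizer HK g lo hi c S| ^+ 2 <= e / c + `|r| ^+ 2.
Proof.
have := minimizer_base.
have := smear_sqr_ge0 nu sample_point (sample_residual (minimizer HK g lo hi c S)).
move=> h1 h2; rewrite -(@ler_pM2l _ c)// mulrDr.
have -> : c * (e / c) = e by field; rewrite gt_eqF.
by lra.
Qed.

(** With f = u + r for the minimizer f, expand |f|^2 in |f|^2 <= e / c + |r|^2. *)
Lemma minimizer_error_sqr : `|u| ^+ 2 <= e / c - 2 * rkhs_dot HK u r.
Proof.
have := norm_minimizer_sqr.
have := rkhs_normD HK u r; rewrite subrK => ->.
by lra.
Qed.

(** The parallelogram law gives |f - r|^2 <= 2 |f|^2 + 2 |r|^2, and |f|^2 is bounded by e / c +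
    |r|^2. *)
Lemma minimizer_error_bounded : `|u| ^+ 2 <= 4 * `|r| ^+ 2 + 2 * (e / c).
Proof.
have := norm_minimizer_sqr.
have := rkhs_parallelogram HK (minimizer HK g lo hi c S) r.
have := exprn_ge0 2 (normr_ge0 (2^-1 *: (minimizer HK g lo hi c S + r))).
by lra.
Qed.

(** A u = (A f - B) - (A r - B), and comparing the risks bounds the first term by e + c |r|^2 in
    squared norm. *)
Lemma minimizer_error_smear : sq (sample_eval u) <= 4 * e + 2 * c * `|r| ^+ 2.
Proof.
have h : sq (sample_eval u) <=
    2 * sq (sample_residual (minimizer HK g lo hi c S)) + 2 * e.
  apply: smear_sqr_le2 => a.
  have -> : sample_eval u = fun i =>
      1 * sample_residual (minimizer HK g lo hi c S) i + (-1) * sample_residual r i.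
    apply/funext => i; rewrite /sample_residual /sample_eval rkhs_evalB; ring.
  rewrite smear_lin.
  have := sqr_ge0 (smear sample_point (sample_residual (minimizer HK g lo hi c S)) a +
                   smear sample_point (sample_residual r) a).
  by rewrite !expr2; lra.
have := minimizer_base.
have : 0 <= c * `|minimizer HK g lo hi c S| ^+ 2.
  by rewrite mulr_ge0 ?exprn_ge0// ltW.
by lra.
Qed.

(** The total weight that multiplies the value at [p] in [eval_error]; it has to stay away from
    0. *)
Definition sample_bump (p : 'rV[R]_d) (rho : R) : R :=
  m%:R^-1 * \sum_i bump p rho (sample_point i).

Lemma sample_bump_ge0 p rho : 0 <= sample_bump p rho.
Proof. by rewrite mulr_ge0 ?invr_ge0// sumr_ge0// => i _; exact: bump_ge0. Qed.

(* Pairing the smeared samples of [w] with [bump_density] averages [w] over the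
   sample points close to [p]. *)
Lemma eval_error (w : H) (p : X) (rho eta t : R) :
  let vol := \prod_i (hi 0 i - lo 0 i) in
  0 < rho -> 0 < t ->
  (forall i, lo 0 i <= (\val p) 0 i - rho /\ (\val p) 0 i + rho <= hi 0 i) ->
  (forall x : X, (forall i, `|(\val x) 0 i - (\val p) 0 i| < rho) ->
    `|rkhs_eval HK w x - rkhs_eval HK w p| <= eta) ->
  sample_bump (\val p) rho * `|rkhs_eval HK w p| <=
    sample_bump (\val p) rho * eta + vol * ((sq (sample_eval w) / t + t) / 2).
Proof.
move=> vol rho0 t0 hp hw.
have vol0 : 0 < vol.
  by apply: prodr_gt0 => i _; have [] := hp i; rewrite subr_gt0; lra.
have mh : measurable_fun setT (bump_density (\val p) rho).
  exact: measurable_bump_density.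
have := smear_pairing nu sample_point (sample_eval w) t0 mh
  (@bump_density_norm _ _ _ _).
(* After exchanging sum and integral, each orthant indicator pairs with the density to a bump. *)
have -> : \int[nu]_a (smear sample_point (sample_eval w) a *
      bump_density (\val p) rho a) =
    vol^-1 * (m%:R^-1 * \sum_i bump (\val p) rho (sample_point i) * sample_eval w i).
  have iI i : nu.-integrable setT
      (EFin \o (fun a => orthant_indicator a (sample_point i) *
        bump_density (\val p) rho a)).
    apply: (bounded_integrable _ (C := 1)).
      apply: measurable_funM => //; apply: measurable_orthant_indicator => // k.
      exact: measurable_rV_coord.
    move=> a; rewrite normrM mulr_ile1// ?bump_density_norm//.
    by rewrite ger0_norm ?orthant_indicator_ge0 ?orthant_indicator_le1.
  have iZ i : nu.-integrable setT (fun a => (m%:R^-1 * sample_eval w i)%:E *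
      (orthant_indicator a (sample_point i) * bump_density (\val p) rho a)%:E)%E.
    by apply: integrableZl => //; exact: iI.
  apply: EFin_inj; rewrite /Rintegral fineK; last first.
    apply: integrable_fin_num => //.
    apply: integrable_smearM => // a; exact: bump_density_norm.
  rewrite (eq_integral (fun a => \sum_i (m%:R^-1 * sample_eval w i)%:E *
      (orthant_indicator a (sample_point i) * bump_density (\val p) rho a)%:E)%E);
    last first.
    move=> a _; rewrite /smear -mulrA mulr_suml mulr_sumr -sumEFin.
    by apply: eq_bigr => i _; rewrite -EFinM; congr EFin; ring.
  rewrite integral_sum// !mulr_sumr -sumEFin; apply: eq_bigr => i _.
  rewrite integralZl//; last exact: iI.
  rewrite integral_orthant_bump_density// -EFinM; congr EFin; ring.
set q := (_ + _) / 2 => h.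
have {}h : `|m%:R^-1 * \sum_i bump (\val p) rho (sample_point i) * sample_eval w i|
    <= vol * q.
  by move: h; rewrite normrM gtr0_norm ?invr_gt0// ler_pdivrMl.
(* The weighted average of the sample values, minus that of their deviations from the value at
   [p]. *)
have e1 : sample_bump (\val p) rho * rkhs_eval HK w p =
    m%:R^-1 * (\sum_i bump (\val p) rho (sample_point i) * sample_eval w i) -
    m%:R^-1 * \sum_i bump (\val p) rho (sample_point i) *
      (sample_eval w i - rkhs_eval HK w p).
  rewrite -mulrBr -sumrB /sample_bump -mulrA mulr_suml; congr (_ * _).
  by apply: eq_bigr => i _; ring.
have e2 : `|m%:R^-1 * \sum_i bump (\val p) rho (sample_point i) *
      (sample_eval w i - rkhs_eval HK w p)| <= sample_bump (\val p) rho * eta.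
  rewrite normrM ger0_norm ?invr_ge0// /sample_bump -mulrA ler_wpM2l ?invr_ge0//.
  apply: le_trans (ler_norm_sum _ _ _) _; rewrite mulr_suml; apply: ler_sum => i _.
  rewrite normrM ger0_norm ?bump_ge0//.
  (* Only sample points in the cube of radius [rho] have nonzero weight, and there [hw] applies. *)
  have [->|bn0] := eqVneq (bump (\val p) rho (sample_point i)) 0.
    by rewrite !mul0r.
  by rewrite ler_wpM2l ?bump_ge0//; apply: hw => j; exact: bump_neq0.
rewrite -[X in X * `|_|](ger0_norm (sample_bump_ge0 (\val p) rho)) -normrM e1.
by apply: le_trans (ler_normB _ _) _; rewrite addrC lerD.
Qed.

End minimizer.

(** * Large samples *)

(** The norm of row vectors is the maximum norm, so its balls are cubes. *)
Lemma nbhs_cube {R : realType} (d : nat) (p : 'rV[R]_d) (P : set 'rV[R]_d) :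
  nbhs p P -> exists2 e : R, 0 < e &
    forall v : 'rV[R]_d, (forall i, `|v 0 i - p 0 i| < e) -> P v.
Proof.
move=> /nbhs_ballP[e /= e0 eP]; exists e => // v hv; apply: eP; split=> // i j.
by rewrite (ord1 i) -ball_normE/= distrC; exact: hv.
Qed.

Lemma interior_rectangle {R : realType} (d : nat) (lo hi p : 'rV[R]_d) :
  (rectangle lo hi)^° p -> exists2 e : R, 0 < e &
    forall i, lo 0 i <= p 0 i - e /\ p 0 i + e <= hi 0 i.
Proof.
move=> /nbhs_cube[e e0 he]; exists (e / 2); first by rewrite divr_gt0.
move=> i.
(* Adding [e / 2] to all coordinates of [p], or subtracting it, stays in the rectangle; these two
   points give all the bounds. *)
have /he/(_ i) : forall j, `|(p + const_mx (e / 2)) 0 j - p 0 j| < e.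
  by move=> j; rewrite !mxE addrAC subrr add0r gtr0_norm; lra.
have /he/(_ i) : forall j, `|(p - const_mx (e / 2)) 0 j - p 0 j| < e.
  by move=> j; rewrite !mxE addrAC subrr add0r normrN gtr0_norm; lra.
by rewrite !mxE => /andP[? ?] /andP[? ?]; split.
Qed.

Section sampling.
Context {R : realType} {d : nat} {X : set 'rV[R]_d} (X0 : X !=set0).
Context {dY : measure_display} {Y : measurableType dY}.
Variables (lo hi : 'rV[R]_d).

Local Notation Z := (borel_sub X0 * Y)%type.
Local Notation nu := (normalized_lebesgue lo hi).

Variable mu : probability Z R.

Lemma measurable_coord_Z i :
  measurable_fun setT (fun z : Z => (\val (z.1 : X)) 0 i).
Proof.
apply: (@measurableT_comp _ _ _ _ _ _
  (fun x : borel_sub X0 => (\val (x : X)) 0 i) _ fst) => //.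
exact: measurable_borel_sub_coord.
Qed.

Section mean_square.
Variable phi : Z -> R.
Hypothesis mphi : measurable_fun setT phi.
Hypothesis iphi2 : mu.-integrable setT (fun z => (phi z ^+ 2)%:E).

Let smeared m (w : m.-tuple Z * 'rV[R]_d) : \bar R :=
  ((smear (sample_point w.1) (fun i => phi (tnth w.1 i)) w.2) ^+ 2)%:E.

Let measurable_smeared m : measurable_fun setT (@smeared m).
Proof.
apply/measurable_EFinP; apply: measurable_funX; apply: measurable_funM => //.
have mt i : measurable_fun setT (fun w : m.-tuple Z * 'rV[R]_d => tnth w.1 i).
  by apply: (@measurableT_comp _ _ _ _ _ _ (fun t : m.-tuple Z => tnth t i) _ fst) => //;
    exact: measurable_tnth.
apply: measurable_sum => i; apply: measurable_funM; last exact: measurableT_comp.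
apply: measurable_orthant_indicator => j.
  by apply: (@measurableT_comp _ _ _ _ _ _ (fun a : 'rV[R]_d => a 0 j) _ snd) => //;
    exact: measurable_rV_coord.
exact: (measurableT_comp (measurable_coord_Z j) (mt i)).
Qed.

Lemma measurable_mean_square m : measurable_fun setT (fun S : m.-tuple Z =>
  (\int[nu]_a (smear (sample_point S) (fun i => phi (tnth S i)) a ^+ 2)%:E)%E).
Proof.
apply: (@measurable_fun_fubini_tonelli_F _ _ _ _ _ nu (@smeared m)) => [|w].
  exact: measurable_smeared.
by rewrite /smeared lee_fin sqr_ge0.
Qed.

Hypothesis iphi : mu.-integrable setT (EFin \o phi).
Hypothesis phi0 : forall a, (\int[mu]_z
  (orthant_indicator a (\val (z.1 : X)) * phi z)%:E = 0)%E.

(** Tonelli's theorem exchanges the sample and [a]. For fixed [a] there remains the variance of a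
    mean of [m] independent centered variables, each at most [phi] in absolute value. *)
Lemma mean_square_le m :
  (\int[mpower mu m]_S
    \int[nu]_a (smear (sample_point S) (fun i => phi (tnth S i)) a ^+ 2)%:E <=
   m%:R^-1%:E * \int[mu]_z (phi z ^+ 2)%:E)%E.
Proof.
have s0 (w : m.-tuple Z * 'rV[R]_d) : (0 <= smeared w)%E.
  by rewrite /smeared lee_fin sqr_ge0.
have -> : (\int[mpower mu m]_S
    \int[nu]_a (smear (sample_point S) (fun i => phi (tnth S i)) a ^+ 2)%:E =
    \int[nu]_a \int[mpower mu m]_S
      (smear (sample_point S) (fun i => phi (tnth S i)) a ^+ 2)%:E)%E.
  exact: (@fubini_tonelli _ _ _ _ _ (@mpow _ _ _ mu m) nu (@smeared m)
    (@measurable_smeared m) s0).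
have mean a : (\int[mpower mu m]_S
    (smear (sample_point S) (fun i => phi (tnth S i)) a ^+ 2)%:E <=
    m%:R^-1%:E * \int[mu]_z (phi z ^+ 2)%:E)%E.
  pose psi (z : Z) := orthant_indicator a (\val (z.1 : X)) * phi z.
  have mpsi : measurable_fun setT psi.
    apply: measurable_funM => //; apply: measurable_orthant_indicator => // j.
    exact: measurable_coord_Z.
  have psi1 z : `|psi z| <= `|phi z|.
    rewrite /psi normrM ger0_norm ?orthant_indicator_ge0//.
    by rewrite ler_piMl// orthant_indicator_le1.
  have psi2 z : psi z ^+ 2 <= phi z ^+ 2.
    by rewrite -real_normK ?num_real// -[leRHS]real_normK ?num_real// ler_pXn2r ?nnegrE.
  have ipsi : mu.-integrable setT (EFin \o psi).
    by apply: le_integrable iphi => //; [exact/measurable_EFinP|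
      move=> z _; rewrite /= lee_fin].
  have ipsi2 : mu.-integrable setT (fun z => (psi z ^+ 2)%:E).
    apply: le_integrable iphi2 => //.
      by apply/measurable_EFinP; exact: measurable_funX.
    by move=> z _; rewrite /= lee_fin !ger0_norm ?sqr_ge0.
  have -> : (\int[mpower mu m]_S
      (smear (sample_point S) (fun i => phi (tnth S i)) a ^+ 2)%:E =
      m%:R^-1%:E * \int[mu]_z (psi z ^+ 2)%:E)%E.
    exact: (mpower_mean_sqr _ mpsi ipsi (phi0 a) ipsi2).
  rewrite lee_wpmul2l ?lee_fin ?invr_ge0//; apply: ge0_le_integral => //.
  - by move=> z _; rewrite lee_fin sqr_ge0.
  - exact: measurable_int ipsi2.
  - exact: measurable_int iphi2.
  - by move=> z _; rewrite lee_fin.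
set C := (_ * _)%E.
have C0 : (0 <= C)%E.
  rewrite mule_ge0 ?lee_fin ?invr_ge0// integral_ge0// => z _.
  by rewrite lee_fin sqr_ge0.
apply: (@le_trans _ _ (\int[nu]_a C)%E); last first.
  by rewrite integral_cst// [X in (_ * X)%E](_ : _ = 1%E) ?mule1//; exact: probability_setT.
apply: ge0_le_integral => //.
- by move=> a _; apply: integral_ge0 => S _; rewrite lee_fin sqr_ge0.
- exact: (@measurable_fun_fubini_tonelli_G _ _ _ _ _ (@mpow _ _ _ mu m)
    (@smeared m) (@measurable_smeared m) s0).
Qed.

End mean_square.

(** Chebyshev's inequality around the mean of one bump; the bound is half that mean, which is
    positive because the support contains [p]. *)
Lemma sample_bump_bounded_below (p : X) (rho : R) : 0 < rho ->
  supportX mu = setT ->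
  exists2 b : R, 0 < b & asymptotically_null mu
    (fun m => [set S : m.-tuple Z | sample_bump S (\val p) rho < b]).
Proof.
move=> rho0 supp.
pose beta (z : Z) := bump (\val p) rho (\val (z.1 : X)).
have mbeta : measurable_fun setT beta.
  apply: measurable_prod => i _; apply: measurable_maxr => //.
  apply: measurable_funB => //; apply: measurableT_comp => //.
  by apply: measurable_funB => //; exact: measurable_coord_Z.
have beta_le z : `|beta z| <= rho ^+ d.
  by rewrite ger0_norm ?bump_ge0// bump_le// ltW.
have ibeta := bounded_integrable mu mbeta beta_le.
pose b := fine (\int[mu]_z (beta z)%:E)%E.
have bE : (\int[mu]_z (beta z)%:E = b%:E)%E.
  by rewrite /b fineK// integrable_fin_num.
have b0 : 0 < b.
  (* On the cube of half the radius every factor of the bump is at least [rho / 2]. *)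
  pose V := [set v : 'rV[R]_d | forall i, `|v 0 i - (\val p) 0 i| < rho / 2].
  have pV : V^° (\val p).
    have rho2 : 0 < rho / 2 by rewrite divr_gt0.
    apply: (@filter_forall _ _ (fun i (v : 'rV[R]_d) =>
      `|v 0 i - (\val p) 0 i| < rho / 2) (nbhs (\val p)) _) => i.
    have := @coord_continuous R 1 d 0 i (\val p).
    by move=> /cvgrPdist_lt/(_ _ rho2); apply: filterS => v /=; rewrite distrC.
  have : supportX mu p by rewrite supp.
  move=> /(_ _ (@open_interior _ V) pV).
  set U := fun x' : X => V^° (\val x') => muU.
  have mU : measurable (U : set (borel_sub X0)).
    apply: measurable_rel_open => x Ux.
    have : nbhs (\val (x : X)) V^° by apply: open_nbhs_nbhs; split; [exact: open_interior|].
    apply: filterS => v Vv x' xv; rewrite /U xv; exact: Vv.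
  have mU' : measurable (fst @^-1` (U : set (borel_sub X0)) : set Z).
    by rewrite -[X in measurable X]setTI; exact: measurable_fst.
  rewrite -lte_fin -bE.
  apply: (@lt_le_trans _ _ (\int[mu]_(z in fst @^-1` U) ((rho / 2) ^+ d)%:E)%E).
    by rewrite integral_cst// mule_gt0// lte_fin exprn_gt0// divr_gt0.
  apply: (@le_trans _ _ (\int[mu]_(z in fst @^-1` U) (beta z)%:E)%E).
    apply: ge0_le_integral => //.
    - by move=> z _; rewrite lee_fin exprn_ge0// divr_ge0// ltW.
    - by apply: measurable_funTS; exact/measurable_EFinP.
    - move=> z /interior_subset Vz; rewrite lee_fin.
      rewrite -[X in _ ^+ X](card_ord d) -prodr_const; apply: ler_prod => i _.
      rewrite divr_ge0 ?(ltW rho0)//= /tent le_max; apply/orP; right.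
      by have := Vz i; lra.
  apply: ge0_subset_integral => //; first exact/measurable_EFinP.
  by move=> z _; rewrite lee_fin bump_ge0.
exists (b / 2); first by rewrite divr_gt0.
pose psi (z : Z) := beta z - b.
have mpsi : measurable_fun setT psi by exact: measurable_funB.
have psi_le z : `|psi z| <= rho ^+ d + b.
  by rewrite (le_trans (ler_normB _ _))// lerD// gtr0_norm.
have ipsi := bounded_integrable mu mpsi psi_le.
have psi0 : (\int[mu]_z (psi z)%:E = 0)%E.
  under eq_integral do rewrite EFinB.
  rewrite integralB// ?bE; last exact: finite_measure_integrable_cst.
  rewrite integral_cst// [X in (_ * X)%E](_ : _ = 1%E); last exact: probability_setT.
  by rewrite mule1 subee.
have ipsi2 : mu.-integrable setT (fun z => (psi z ^+ 2)%:E).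
  apply: (bounded_integrable mu (f := fun z => psi z ^+ 2)
    (C := (rho ^+ d + b) ^+ 2)); first exact: measurable_funX.
  move=> z; rewrite normrX ler_pXn2r ?nnegrE ?addr_ge0 ?exprn_ge0 ?(ltW b0)//.
  by rewrite ltW.
pose W m (S : m.-tuple Z) : \bar R := ((m%:R^-1 * \sum_i psi (tnth S i)) ^+ 2)%:E.
apply: (@asymptotically_null_sub _ _ _ _ _
  (fun m => [set S | ((b / 2) ^+ 2)%:E <= W m S]%E)).
  (* A positive [m] is needed for the average of the constant [b] to be [b]. *)
  exists 1%N => // m /= m1 S /= hS.
  rewrite /W lee_fin.
  have -> : m%:R^-1 * \sum_i psi (tnth S i) = sample_bump (X0 := X0) S (\val p) rho - b.
    rewrite /psi sumrB mulrBr sumr_const card_ord -(mulr_natl b m) mulKf//.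
    by rewrite pnatr_eq0 -lt0n.
  have sqr_le (s t : R) : 0 < t -> s < t / 2 -> (t / 2) ^+ 2 <= (s - t) ^+ 2.
    by move=> t0 st; rewrite -[leRHS]sqrrN ler_pXn2r ?nnegrE//; lra.
  exact: sqr_le b0 hS.
apply: (asymptotically_null_markov (B := fun m => m%:R^-1 *
    fine (\int[mu]_z (psi z ^+ 2)%:E)%E)).
- move=> m; apply/measurable_EFinP; apply: measurable_funX.
  by apply: measurable_funM => //; exact: measurable_sum_tnth.
- by move=> m S; rewrite lee_fin sqr_ge0.
- by rewrite exprn_gt0// divr_gt0.
- apply: nearW => m; rewrite /W mpower_mean_sqr// EFinM fineK//.
  exact: integrable_fin_num.
- rewrite -[X in _ --> X](mul0r (fine (\int[mu]_z (psi z ^+ 2)%:E)%E)).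
  apply: cvgMr_tmp; apply/gtr0_cvgV0; last exact: cvgr_idn.
  by near=> m; rewrite ltr0n; near: m; exact: nbhs_infty_gt.
Unshelve. all: by end_near. Qed.

End sampling.

(* The vectors [v] for which the conclusion holds form a closed subspace, which
   contains the sections of the kernel. *)
Lemma asymptotically_null_dot {R : realType} {T' : Type} {K : T' -> T' -> R}
    {H : completeNormedModType R} (HK : rkhs K H)
    d (T : measurableType d) (mu : probability T R)
    (u : forall m, m.-tuple T -> H) (C : R) : 0 < C ->
  asymptotically_null mu (fun m => [set S | C <= `|u m S|]) ->
  (forall p e, 0 < e ->
    asymptotically_null mu (fun m => [set S | e <= `|rkhs_eval HK (u m S) p|])) ->
  forall v e, 0 < e ->
    asymptotically_null mu (fun m => [set S | e <= `|rkhs_dot HK (u m S) v|]).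
Proof.
move=> C0 uC up v.
pose W : set H := [set v | forall e, 0 < e ->
  asymptotically_null mu (fun m => [set S | e <= `|rkhs_dot HK (u m S) v|])].
suff WT : W = setT by suff : W v by []; rewrite WT.
apply: (rkhs_sections_total (HK := HK)).
- move=> e e0; apply: asymptotically_null_sub (uC).
  by apply: nearW => m S /=; rewrite linear0r normr0 leNgt e0.
- move=> v1 v2 W1 W2 e e0; have e2 : 0 < e / 2 by rewrite divr_gt0.
  apply: asymptotically_null_sub (asymptotically_nullU (W1 _ e2) (W2 _ e2)).
  apply: nearW => m S /=; rewrite rkhs_dotDr => he.
  have := le_trans he (ler_normD _ _).
  have [h1|h1] := leP (e / 2) `|rkhs_dot HK (u m S) v1|; first by left.
  by right; lra.
- move=> a v1 W1 e e0; have a0 : 0 < `|a| + 1 by rewrite ltr_wpDl.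
  have ea0 : 0 < e / (`|a| + 1) by rewrite divr_gt0.
  apply: asymptotically_null_sub (W1 _ ea0).
  apply: nearW => m S /=; rewrite rkhs_dotZr normrM ler_pdivrMr// => he.
  by rewrite (le_trans he)// mulrC ler_wpM2l// lerDl.
- move=> v1 clv1 e e0.
  (* Where |u| < C, replacing [v1] by a vector this close changes the inner product by at most
     [e / 2]. *)
  have eC : 0 < e / (2 * C) by rewrite divr_gt0// mulr_gt0.
  have [v2 [W2 v12]] := clv1 _ (nbhsx_ballx v1 _ eC).
  have e2 : 0 < e / 2 by rewrite divr_gt0.
  apply: asymptotically_null_sub (asymptotically_nullU uC (W2 _ e2)).
  apply: nearW => m S /= he.
  have [h1|h1] := leP C `|u m S|; [by left|right].
  move: v12; rewrite -ball_normE /= => v12.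
  have h2 : `|rkhs_dot HK (u m S) (v1 - v2)| <= e / 2.
    apply: le_trans (rkhs_cauchy_schwarz _ _ _) _.
    have -> : e / 2 = C * (e / (2 * C)) by field; rewrite gt_eqF.
    by rewrite ler_pM// ltW.
  rewrite linearBr in h2.
  have := ler_distD 0 (rkhs_dot HK (u m S) v1) (rkhs_dot HK (u m S) v2).
  have := lerB_dist (rkhs_dot HK (u m S) v1) (rkhs_dot HK (u m S) v2).
  by move: h2 he; lra.
- move=> p e e0; apply: asymptotically_null_sub (up p e e0).
  by apply: nearW => m S /=; rewrite -rkhs_evalE.
Qed.

(* Eventually beta^2 >= 1 / gamma >= 1 and ln m >= 1, hence the denominator of
   the rate is at least 1. *)
Lemma rate_cvgy {R : realType} (gamma beta : nat -> R) :
  (forall m, (0 < m)%N -> 0 < gamma m) ->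
  (forall m, (0 < m)%N -> 0 < beta m) ->
  gamma m @[m --> \oo] --> 0 ->
  beta m * Num.sqrt (gamma m) @[m --> \oo] --> +oo ->
  m%:R * gamma m / (beta m ^+ 2 * ln m%:R) @[m --> \oo] --> +oo ->
  m%:R * gamma m @[m --> \oo] --> +oo.
Proof.
move=> gamma_gt0 beta_gt0 gamma0 betagamma rate.
apply/cvgryPge => A.
near=> m.
have m0 : (0 < m)%N by near: m; exact: nbhs_infty_gt.
have g0 := gamma_gt0 _ m0; have b0 := beta_gt0 _ m0.
have h1 : A <= m%:R * gamma m / (beta m ^+ 2 * ln m%:R).
  by near: m; move/cvgryPge : rate; exact.
have h2 : 1 <= beta m * Num.sqrt (gamma m).
  by near: m; move/cvgryPge : betagamma; exact.
have h3 : gamma m <= 1.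
  by near: m; apply: (cvgr_le _ gamma0).
have h4 : 1 <= ln (m%:R : R).
  rewrite -[leLHS](@expRK R) ler_ln ?posrE ?expR_gt0 ?ltr0n//.
  by near: m; exact: nbhs_infty_ger.
apply: le_trans h1 _.
have h5 : 1 <= beta m ^+ 2 * ln m%:R.
  have : 1 <= beta m ^+ 2 * gamma m.
    by rewrite -(sqr_sqrtr (ltW g0)) -exprMn exprn_ege1.
  move=> h5; rewrite -[leLHS]mulr1 ler_pM//.
  by rewrite (le_trans h5)// ler_piMr// exprn_ge0// ltW.
rewrite ler_pdivrMr; last exact: lt_le_trans h5.
by rewrite ler_peMr// mulr_ge0// ltW.
Unshelve. all: by end_near. Qed.

(** * Convergence of the minimizers to the regression function *)

Theorem theorem3p3 (R : realType) (d : nat)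
  (X : set 'rV[R]_d) (X0 : X !=set0)
  (hXcompact : compact X) (hXsmooth : smooth_submanifold X)
  (dY : measure_display) (Y : measurableType dY)
  (lo hi : 'rV[R]_d) (hXQ : X `<=` interior (rectangle lo hi))
  (K : X -> X -> R) (hK : smooth_mercer_kernel K)
  (H : completeNormedModType R) (HK : rkhs K H)
  (g : Y -> R) (hg : measurable_fun [set: Y] g)
  (M : R)
  (hM : (ereal_sup [set \int[marginalY mu]_y (`|g y| ^+ 2)%:E
                   | mu in P_K X0 HK g] <= M%:E)%E)
  (gamma : nat -> R) (hgamma : forall m, (0 < m)%N -> 0 < gamma m)
  (beta : nat -> R) (hbeta : forall m, (0 < m)%N -> 0 < beta m)
  (hgamma0 : gamma m @[m --> \oo] --> 0)
  (hbetagamma : beta m * Num.sqrt (gamma m) @[m --> \oo] --> +oo)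
  (hrate : m%:R * gamma m / (beta m ^+ 2 * ln m%:R) @[m --> \oo] --> +oo)
  (mu : probability (borel_sub X0 * Y)%type R) (hmu : P_K X0 HK g mu)
  (r : H) (hr : regression_version HK g mu r)
  (eps : R) (heps : 0 < eps) :
  mu_ext (mpower mu m)
    [set S : m.-tuple (borel_sub X0 * Y) |
      eps <= `|minimizer HK g lo hi (gamma m) S - r|] @[m --> \oo] --> 0%E.
Proof.
pose nu := normalized_lebesgue lo hi.
have [supp ig1 _] := hmu.
have mf : measurable_fun setT (rkhs_eval HK r : borel_sub X0 -> R).
  by apply: measurable_fun_borel_sub => x eta; exact: rkhs_eval_near.
(* Boundedness of [r] on the compact set gives the integrability of [r] and helps with that of the
   squared residual. *)
have [B hB] := rkhs_eval_bounded hK HK hXcompact r.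
pose f : borel_sub X0 -> R := rkhs_eval HK r.
have mfZ : measurable_fun setT (fun z : borel_sub X0 * Y => f z.1).
  exact: measurableT_comp.
have mgZ : measurable_fun setT (fun z : borel_sub X0 * Y => g z.2).
  exact: measurableT_comp.
have igZ := integrable_marginalY hg ig1.
have ifZ : mu.-integrable setT (fun z => (f z.1)%:E).
  by apply: (bounded_integrable mu mfZ (C := B)) => z; exact: hB.
pose phi (z : borel_sub X0 * Y) : R := f z.1 - g z.2.
have mphi : measurable_fun setT phi by exact: measurable_funB.
have iphi : mu.-integrable setT (EFin \o phi).
  rewrite (_ : _ \o _ = (fun z => (f z.1)%:E - (g z.2)%:E)%E)//.
  exact: integrableB.
have g2 : (\int[mu]_z (g z.2 ^+ 2)%:E < +oo)%E.
  have mg2 : measurable_fun setT (fun y => (g y ^+ 2)%:E).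
    by apply/measurable_EFinP; exact: measurable_funX.
  rewrite -(ge0_integral_marginalY mu mg2); last by move=> y; rewrite lee_fin sqr_ge0.
  (* The supremum over all admissible measures bounds the second moment of [g] under this one. *)
  apply: (@le_lt_trans _ _ M%:E); last exact: ltry.
  apply: le_trans hM; apply: ereal_sup_ubound; exists mu => //.
  by congr integral; apply/funext => y; rewrite real_normK ?num_real.
have iphi2 : mu.-integrable setT (fun z => (phi z ^+ 2)%:E).
  have ig2 : mu.-integrable setT (fun z => (g z.2 ^+ 2)%:E).
    apply/integrableP; split; first by apply/measurable_EFinP; exact: measurable_funX.
    by under eq_integral do rewrite gee0_abs ?lee_fin ?sqr_ge0//.
  (* The dominating function comes from (f - g)^2 <= 2 f^2 + 2 g^2 and the bound [B] on [f]. *)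
  have idom : mu.-integrable setT
      (fun z : borel_sub X0 * Y => (2 * B ^+ 2)%:E + 2%:E * (g z.2 ^+ 2)%:E)%E.
    apply: integrableD => //; first exact: finite_measure_integrable_cst.
    exact: integrableZl.
  apply: le_integrable idom => //.
    by apply/measurable_EFinP; exact: measurable_funX.
  move=> z _; rewrite -EFinM -EFinD /= lee_fin.
  have B2 : f z.1 ^+ 2 <= B ^+ 2.
    rewrite -real_normK ?num_real// ler_pXn2r ?nnegrE//.
    exact: le_trans (hB z.1).
  have B0 := sqr_ge0 B; have g0 := sqr_ge0 (g z.2).
  rewrite !ger0_norm ?sqr_ge0//; last by lra.
  have := sqr_ge0 (f z.1 + g z.2); rewrite /phi.
  by rewrite !expr2 in B2 B0 g0 *; lra.
have phi0 a : (\int[mu]_z (orthant_indicator a (\val (z.1 : X)) * phi z)%:E = 0)%E.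
  pose A : set (borel_sub X0) :=
    [set x : X | forall i, (\val x) 0 i <= a 0 i].
  have mA : measurable A.
    rewrite (_ : A = \bigcap_(i in setT)
        ((fun x : borel_sub X0 => (\val (x : X)) 0 i) @^-1` `]-oo, a 0 i])).
      apply: fin_bigcap_measurable => // i _; rewrite -[X in measurable X]setTI.
      by apply: measurable_borel_sub_coord => //; exact: measurable_itv.
    by apply/seteqP; split=> x /= hx i; have := hx i; rewrite ?in_itv//=; apply.
  have [k hk hfk] := hr.
  rewrite -[RHS](integral_residual hk hg igZ mf ifZ hfk mA).
  apply: eq_integral => z _; congr ((_ * _)%:E).
  rewrite orthant_indicatorE !indicE; congr ((nat_of_bool _)%:R).
pose D := fine (\int[mu]_z (phi z ^+ 2)%:E)%E.
have DE : (\int[mu]_z (phi z ^+ 2)%:E = D%:E)%E.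
  by rewrite /D fineK// integrable_fin_num.
have mgamma := rate_cvgy hgamma hbeta hgamma0 hbetagamma hrate.
pose e m (S : m.-tuple (borel_sub X0 * Y)) : R :=
  smear_sqr nu (sample_point S) (sample_residual HK g S r).
pose u m (S : m.-tuple (borel_sub X0 * Y)) : H :=
  minimizer HK g lo hi (gamma m) S - r.
have null_e tau : 0 < tau ->
    asymptotically_null mu (fun m => [set S | tau <= @e m S / gamma m]).
  move=> tau0.
  (* The absolute value keeps [Xi] nonnegative for [m = 0] too, where the sign of [gamma] is
     unknown. *)
  pose Xi m (S : m.-tuple (borel_sub X0 * Y)) : \bar R := (`|gamma m|^-1%:E *
    \int[nu]_a (smear (sample_point S) (fun i => phi (tnth S i)) a ^+ 2)%:E)%E.
  have Xi0 m S : (0 <= @Xi m S)%E.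
    rewrite mule_ge0 ?lee_fin ?invr_ge0// integral_ge0// => a _.
    by rewrite lee_fin sqr_ge0.
  apply: (@asymptotically_null_sub _ _ _ _ _ (fun m => [set S | tau%:E <= @Xi m S]%E)).
    exists 1%N => // m /= m1 S /= hS; rewrite /Xi smear_sqrE -EFinM lee_fin.
    by rewrite gtr0_norm ?hgamma// mulrC.
  apply: (asymptotically_null_markov (B := fun m => `|gamma m|^-1 * (m%:R^-1 * D))) => //.
  - move=> m; apply: measurable_funeM; exact: measurable_mean_square.
  - apply: nearW => m; rewrite /Xi ge0_integralZl//.
    + rewrite EFinM lee_wpmul2l ?lee_fin ?invr_ge0// EFinM -DE.
      exact: mean_square_le.
    + exact: measurable_mean_square.
    + by move=> S _; apply: integral_ge0 => a _; rewrite lee_fin sqr_ge0.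
  (* The mean of e / gamma is at most D / (m gamma), and m gamma tends to infinity. *)
  - have : (m%:R * gamma m)^-1 * D @[m --> \oo] --> 0 * D.
      apply: cvgMr_tmp; apply/gtr0_cvgV0 => //.
      by exists 1%N => // m /= m1; rewrite mulr_gt0 ?ltr0n ?hgamma.
    rewrite mul0r; apply: cvg_trans; apply: near_eq_cvg.
    exists 1%N => // m /= m1; rewrite gtr0_norm ?hgamma// invfM mulrA.
    by congr (_ * _); rewrite mulrC.
(* Large enough for C^2 to exceed 4 |r|^2 + 2, the bound on |u|^2 when e / gamma is at most 1. *)
pose C := 2 * `|r| + 2.
have C0 : 0 < C by rewrite /C; have := normr_ge0 r; lra.
have C2 : 4 * `|r| ^+ 2 + 2 < C ^+ 2.
  by rewrite /C !expr2; have := normr_ge0 r; nra.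
clearbody C.
have null_C : asymptotically_null mu (fun m => [set S | C <= `|@u m S|]).
  apply: asymptotically_null_sub (null_e 1 ltr01).
  exists 1%N => // m /= m1 S /= hS; rewrite leNgt; apply/negP => he.
  have := minimizer_error_bounded (X0 := X0) HK g lo hi (hgamma _ m1) S r.
  rewrite -/(e m S) -/(u m S) => hb.
  have : C ^+ 2 <= `|@u m S| ^+ 2 by rewrite ler_pXn2r ?nnegrE// ltW.
  by lra.
have null_eval p eta : 0 < eta ->
    asymptotically_null mu (fun m => [set S | eta <= `|rkhs_eval HK (@u m S) p|]).
  move=> eta0.
  have [rho1 rho10 hrho1] := interior_rectangle (hXQ _ (set_valP p)).
  (* If |u| < C, then [u] differs from its value at [p] by at most [eta / 4] on the cube. *)
  have etaC : 0 < eta / (4 * C) by rewrite divr_gt0// mulr_gt0.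
  have [rho2 rho20 hrho2] := nbhs_cube (rkhs_section_near hK HK p etaC).
  pose rho := Num.min rho1 rho2.
  have rho0 : 0 < rho by rewrite lt_min rho10.
  have hrho i : lo 0 i <= (\val p) 0 i - rho /\ (\val p) 0 i + rho <= hi 0 i.
    have [? ?] := hrho1 i; have : rho <= rho1 by rewrite ge_min lexx.
    by split; lra.
  have hsec w (x : X) : (forall i, `|(\val x) 0 i - (\val p) 0 i| < rho) ->
      `|rkhs_eval HK w x - rkhs_eval HK w p| <= `|w| * (eta / (4 * C)).
    move=> hx; rewrite !rkhs_evalE -linearBr.
    apply: le_trans (rkhs_cauchy_schwarz _ _ _) _; rewrite ler_wpM2l//.
    apply: (hrho2 (\val x)) => // i.
    by rewrite (lt_le_trans (hx i))// ge_min lexx orbT.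
  have [b b0 null_b] := sample_bump_bounded_below p rho0 supp.
  pose vol := \prod_i (hi 0 i - lo 0 i).
  have vol0 : 0 < vol.
    by apply: prodr_gt0 => i _; have [] := hrho i; rewrite subr_gt0; lra.
  (* Chosen so that [vol * t / 2] is [b * eta / 4]. *)
  pose t := b * eta / (2 * vol).
  have t0 : 0 < t by rewrite divr_gt0// mulr_gt0.
  (* The factor of [gamma m] in the other half of the pairing bound, which therefore tends to 0. *)
  pose A := vol * ((4 + 2 * `|r| ^+ 2) / t / 2).
  have A0 : 0 <= A.
    have n0 : 0 <= 4 + 2 * `|r| ^+ 2 by rewrite addr_ge0// mulr_ge0// exprn_ge0.
    by rewrite /A !mulr_ge0 ?invr_ge0 ?(ltW t0) ?(ltW vol0).
  (* Outside three events, namely e / gamma >= 1, |u| >= C and total weight below [b], the value of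
     [u] at [p] is smaller than [eta]. *)
  apply: asymptotically_null_sub (asymptotically_nullU (null_e 1 ltr01)
    (asymptotically_nullU null_C null_b)).
  near=> m; move=> S /= hS.
  have m1 : (0 < m)%N by near: m; exact: nbhs_infty_gt.
  have gm0 := hgamma _ m1.
  have Agm : A * gamma m < b * eta / 4.
    near: m; apply: (cvgr_lt (A * 0)); first exact: cvgMl_tmp.
    by rewrite mulr0 divr_gt0// mulr_gt0.
  have [h1|h1] := leP 1 (@e m S / gamma m); first by left.
  right; have [h2|h2] := leP C `|@u m S|; [by left|right].
  rewrite /= ltNge; apply/negP => h3.
  have h4 := eval_error (X0 := X0) S rho0 t0 hrho (hsec (@u m S)).
  have h5 := minimizer_error_smear (X0 := X0) HK g lo hi gm0 S r.
  rewrite -/(e m S) -/(u m S) in h5.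
  have e_lt : @e m S < gamma m by move: h1; rewrite ltr_pdivrMr// mul1r.
  set s := sample_bump _ _ _ in h3 h4.
  set q := smear_sqr _ _ _ in h4 h5.
  have hq : q <= (4 + 2 * `|r| ^+ 2) * gamma m by lra.
  have hA : vol * ((q / t + t) / 2) <= A * gamma m + b * eta / 4.
    have -> : b * eta / 4 = vol * t / 2 by rewrite /t; field; rewrite gt_eqF.
    have -> : A * gamma m = vol * ((4 + 2 * `|r| ^+ 2) * gamma m / t / 2).
      by rewrite /A; field; rewrite gt_eqF.
    have : q / t <= (4 + 2 * `|r| ^+ 2) * gamma m / t by rewrite ler_pM2r ?invr_gt0.
    rewrite -(ler_pM2l vol0); lra.
  have hu : `|@u m S| * (eta / (4 * C)) <= eta / 4.
    have -> : eta / 4 = C * (eta / (4 * C)) by field; rewrite gt_eqF.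
    by rewrite ler_pM2r// ltW.
  have s0 : 0 < s by exact: lt_le_trans h3.
  (* If |u(p)| >= eta, then [eval_error] bounds s eta by s eta / 4 + A gamma + b eta / 4. As A gamma
     < b eta / 4 and b <= s, this is less than 3/4 of s eta. *)
  have l1 : s * (`|@u m S| * (eta / (4 * C))) <= s * (eta / 4) by rewrite ler_pM2l.
  have l2 : s * eta <= s * `|rkhs_eval HK (@u m S) p| by rewrite ler_pM2l.
  have l3 : b * eta <= s * eta by rewrite ler_pM2r.
  have l4 : 0 < s * eta by rewrite mulr_gt0.
  move: l1 l2 l3 l4 h4 hA Agm.
  move: (s * (_ * _)) (A * _) (vol * _) => y1 y2 y3; clear; lra.
have null_dot := asymptotically_null_dot C0 null_C null_eval r.
have e2 : 0 < eps ^+ 2 by rewrite exprn_gt0.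
(* With e / gamma < eps^2 / 2 and |<u, r>| < eps^2 / 8, the bound e / gamma - 2 <u, r> on |u|^2
   stays below 3/4 of eps^2. *)
have e21 : 0 < eps ^+ 2 / 2 by rewrite divr_gt0.
have e28 : 0 < eps ^+ 2 / 8 by rewrite divr_gt0.
apply: asymptotically_null_sub
  (asymptotically_nullU (null_e _ e21) (null_dot _ e28)).
exists 1%N => // m /= m1 S /= hS.
have [h1|h1] := leP (eps ^+ 2 / 2) (@e m S / gamma m); [by left|right].
rewrite leNgt; apply/negP => h2.
have := minimizer_error_sqr (X0 := X0) HK g lo hi (hgamma _ m1) S r.
rewrite -/(e m S) -/(u m S) => hb.
have : eps ^+ 2 <= `|@u m S| ^+ 2 by rewrite ler_pXn2r ?nnegrE// ltW.
have := ler_norm (- rkhs_dot HK (@u m S) r); rewrite normrN.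
by lra.
Unshelve. all: by end_near. Qed.
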